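(* Let $(M,J,g)$ be a flat Kähler Norden manifold and let $\nabla$ be the Levi-Civita connection of $g$. Let $$\tilde J=\Phi^{\nabla}\circ\widehat J\circ(\Phi^{\nabla})^{-1},\qquad \tilde g=((\Phi^{\nabla})^{-1})^{\star}(\widehat g)$$ be the structure on $T^{\star}(M)$ obtained by transporting the Norden structure $(\widehat J,\widehat g)$ of $T(M)\oplus T^{\star}(M)$ through $\Phi^{\nabla}$. Then $(T^{\star}(M),\tilde J,\tilde g)$ is a flat Kähler Norden manifold.
   Context: $M$ is a smooth manifold of dimension $n$. A Norden manifold $(M,J,g)$ is an almost complex manifold $(M,J)$ ($J^2=-I$) with a pseudo-Riemannian metric $g$ such that $g(JX,Y)=g(X,JY)$ for all $X,Y$. It is a Kähler Norden manifold if $\nabla J=0$, where $\nabla$ is the Levi-Civita connection of $g$. It is flat if the Riemann curvature tensor of $g$ (the curvature of the Levi-Civita connection) vanishes. Norden structure on $T(M)\oplus T^{\star}(M)$. Let $\flat:T(M)\to T^{\star}(M)$, $\flat(X)(Y)=g(X,Y)$, also denoted $g$, $\natural=\flat^{-1}$, and $J^{\star}(\xi)(X)=\xi(JX)$. Define $$\widehat J(X+\xi)=JX+g(X)-J^{\star}(\xi),$$ $$\widehat g(X+\xi,Y+\eta)=g(X,Y)+\tfrac12 g(JX,\natural\eta)+\tfrac12 g(\natural\xi,JY)+g(\natural\xi,\natural\eta).$$ The map $\Phi^{\nabla}$. Let $\Gamma^k_{il}$ be the Christoffel symbols of $\nabla$: $\nabla_{\partial/\partial x^i}\frac{\partial}{\partial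 x^l}=\Gamma^k_{il}\frac{\partial}{\partial x^k}$ in local coordinates $x^1,\dots,x^n$ of $M$, and let $\tilde x^1,\dots,\tilde x^n,y_1,\dots,y_n$ be the corresponding local coordinates on $T^{\star}(M)$. For each $p\in T^{\star}(M)$ over $x\in M$, $\Phi^{\nabla}:T_xM\oplus T_x^{\star}M\to T_p(T^{\star}(M))$ is the linear isomorphism with $$\Phi^{\nabla}\Big(\frac{\partial}{\partial x^i}\Big)=\frac{\partial}{\partial\tilde x^i}+y_k\Gamma^k_{il}\frac{\partial}{\partial y_l},\qquad \Phi^{\nabla}(dx^j)=\frac{\partial}{\partial y_j}$$ (summation over repeated indices), i.e. the $\nabla$-horizontal lift on vectors and the vertical lift on covectors. The formulas for $\tilde J,\tilde g$ are understood pointwise at each $p\in T^{\star}(M)$. *)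

(* Defs.v *)
From HB Require Import structures.
From mathcomp Require Import all_boot all_order all_algebra.
From mathcomp Require Import all_classical all_reals all_analysis.
Import Order.TTheory GRing.Theory Num.Theory numFieldNormedType.Exports.

Set Implicit Arguments.
Unset Strict Implicit.
Unset Printing Implicit Defensive.

Local Open Scope classical_set_scope.
Local Open Scope ring_scope.

(* Conventions.  Points of R^n are row vectors.  Components of tangent vectors
   (with respect to the basis d/dx^a) and of covectors (with respect to dx^a)
   are column vectors, so that an endomorphism J acts by X |-> J *m X, with
   J a b = J^a_b, and a bilinear form g is X, Y |-> X^T *m g *m Y, with
   g a b = g_ab. *)

Section Calculus.
Context {R : realType} {n : nat}.

Definition partial (a : 'I_n) (f : 'rV[R]_n -> R) (x : 'rV[R]_n) : R :=
  derive f x (delta_mx 0 a).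

(* [differentiable] is Frechet differentiability. *)
Fixpoint Ck (k : nat) (D : set 'rV[R]_n) (f : 'rV[R]_n -> R) : Prop :=
  if k is k'.+1 then
    (forall x, D x -> differentiable f x) /\
    (forall a : 'I_n, Ck k' D (partial a f))
  else forall x, D x -> {for x, continuous f}.

Definition smooth_on (D : set 'rV[R]_n) (f : 'rV[R]_n -> R) : Prop :=
  forall k, Ck k D f.

End Calculus.

(* [param i] is the inverse of the chart [coord i]; it is only meaningful on
   [coord i @` dom i]. *)
Record atlas (R : realType) (n : nat) (M : topologicalType) := Atlas {
  idx : Type;
  dom : idx -> set M;
  coord : idx -> M -> 'rV[R]_n;
  param : idx -> 'rV[R]_n -> M }.

Section Manifold.
Context {R : realType} {n : nat} {M : topologicalType} (A : atlas R n M).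
Implicit Types (i j : idx A) (p : M) (a : 'I_n).

Definition chart_image i (U : set M) : set 'rV[R]_n := coord i @` (dom i `&` U).

Record smooth_manifold : Prop := SmoothManifold {
  sm_hausdorff : hausdorff_space M;
  sm_second_countable : @second_countable M;
  sm_cover : forall p, exists i, dom i p;
  sm_dom_open : forall i, open (dom i);
  sm_image_open : forall i, open (chart_image i setT);
  sm_coordK : forall i p, dom i p -> param i (coord i p) = p;
  sm_coord_continuous : forall i p, dom i p -> {for p, continuous (coord i)};
  sm_param_continuous : forall i x,
    chart_image i setT x -> {for x, continuous (param i)};
  sm_transition : forall i j (b : 'I_n),
    smooth_on (chart_image i (dom j)) (fun x => coord j (param i x) 0 b) }.

Definition smooth_in_chart i (f : M -> R) : Prop :=
  smooth_on (chart_image i setT) (f \o param i).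

(* d f / d x_i^a *)
Definition chart_partial i a (f : M -> R) (p : M) : R :=
  partial a (f \o param i) (coord i p).

Definition chart_partial_mx i a (F : M -> 'M[R]_n) (p : M) : 'M[R]_n :=
  \matrix_(b, c) chart_partial i a (fun q => F q b c) p.

(* [jac i j p] b a = d x_j^b / d x_i^a *)
Definition jac i j (p : M) : 'M[R]_n :=
  \matrix_(b, a) chart_partial i a (fun q => coord j q 0 b) p.

(* A tensor field of order 2 is given by its matrix of components in each chart
   of the atlas; values of [T i] outside [dom i] are irrelevant. *)
Definition tensor2 := idx A -> M -> 'M[R]_n.

Definition smooth_tensor2 (T : tensor2) : Prop :=
  forall i b c, smooth_in_chart i (fun p => T i p b c).

Definition endomorphism_field (J : tensor2) : Prop :=
  smooth_tensor2 J /\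
  forall i j p, dom i p -> dom j p -> J j p *m jac i j p = jac i j p *m J i p.

Definition bilinear_field (g : tensor2) : Prop :=
  smooth_tensor2 g /\
  forall i j p, dom i p -> dom j p ->
    g i p = (jac i j p)^T *m g j p *m jac i j p.

Definition form {m : nat} (g : 'M[R]_m) (X Y : 'cV[R]_m) : R :=
  (X^T *m g *m Y) 0 0.

Definition almost_complex (J : tensor2) : Prop :=
  endomorphism_field J /\
  forall i p, dom i p -> J i p *m J i p = - 1%:M.

Definition pseudo_riemannian (g : tensor2) : Prop :=
  [/\ bilinear_field g,
      forall i p, dom i p -> forall X Y, form (g i p) X Y = form (g i p) Y X
    & forall i p, dom i p -> forall X,
        (forall Y, form (g i p) X Y = 0) -> X = 0].

Definition norden_manifold (J g : tensor2) : Prop :=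
  [/\ smooth_manifold, almost_complex J, pseudo_riemannian g
    & forall i p, dom i p -> forall X Y,
        form (g i p) (J i p *m X) Y = form (g i p) X (J i p *m Y)].

(* An affine connection is given by its Christoffel symbols in each chart:
   [G i p a] k l = Gamma^k_{al}, where
   nabla_{d/dx^a} d/dx^l = Gamma^k_{al} d/dx^k. *)
Definition christoffel := idx A -> M -> 'I_n -> 'M[R]_n.

(* The second clause is the transformation law
   (d x_j^d / d x_i^c) Gamma_i^c_{ab} = d^2 x_j^d / d x_i^a d x_i^b
     + Gamma_j^d_{ef} (d x_j^e / d x_i^a) (d x_j^f / d x_i^b). *)
Definition affine_connection (G : christoffel) : Prop :=
  (forall i a k l, smooth_in_chart i (fun p => G i p a k l)) /\
  forall i j p, dom i p -> dom j p -> forall a,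
    jac i j p *m G i p a =
      chart_partial_mx i a (jac i j) p
      + \sum_(e < n) jac i j p e a *: (G j p e *m jac i j p).

Definition torsion_free (G : christoffel) : Prop :=
  forall i p, dom i p -> forall a b k, G i p a k b = G i p b k a.

(* Components of nabla_{d/dx^a} J for an endomorphism field J *)
Definition nabla_endo (G : christoffel) (J : tensor2) i p a : 'M[R]_n :=
  chart_partial_mx i a (J i) p + G i p a *m J i p - J i p *m G i p a.

(* Components of nabla_{d/dx^a} g for a bilinear field g *)
Definition nabla_form (G : christoffel) (g : tensor2) i p a : 'M[R]_n :=
  chart_partial_mx i a (g i) p - (G i p a)^T *m g i p - g i p *m G i p a.

(* Matrix of the endomorphism R(d/dx^a, d/dx^b) *)
Definition curvature (G : christoffel) i p a b : 'M[R]_n :=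
  chart_partial_mx i a (fun q => G i q b) p
  - chart_partial_mx i b (fun q => G i q a) p
  + G i p a *m G i p b - G i p b *m G i p a.

Definition levi_civita (g : tensor2) (G : christoffel) : Prop :=
  [/\ affine_connection G, torsion_free G
    & forall i p, dom i p -> forall a, nabla_form G g i p a = 0].

Definition kahler_norden_manifold (J g : tensor2) : Prop :=
  norden_manifold J g /\
  exists2 G, levi_civita g G &
    forall i p, dom i p -> forall a, nabla_endo G J i p a = 0.

Definition flat_metric (g : tensor2) : Prop :=
  exists2 G, levi_civita g G &
    forall i p, dom i p -> forall a b, curvature G i p a b = 0.

Definition flat_kahler_norden_manifold (J g : tensor2) : Prop :=
  kahler_norden_manifold J g /\ flat_metric g.

End Manifold.

Section Cotangent.
Context {R : realType} {n : nat} {M : topologicalType}.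

(* A covector at [base] is the family of its components y_k in the charts around
   [base].  The other entries of the family are 0, so that two elements are
   equal if and only if they are the same covector at the same point. *)
Record cotangent (A : atlas R n M) := Cotangent {
  base : M;
  comp : idx A -> 'rV[R]_n;
  _ : (forall i, ~ dom i base -> comp i = 0) /\
      (forall i j, dom i base -> dom j base ->
         comp i = comp j *m jac i j base) }.

HB.instance Definition _ (A : atlas R n M) := gen_eqMixin (cotangent A).
HB.instance Definition _ (A : atlas R n M) := gen_choiceMixin (cotangent A).

Context (A : atlas R n M).
Implicit Types (i : idx A) (q : cotangent A).

Definition ct_dom i : set (cotangent A) := [set q | dom i (base q)].

(* (x~^1, .., x~^n, y_1, .., y_n) *)
Definition ct_coord i q : 'rV[R]_(n + n) := row_mx (coord i (base q)) (comp q i).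

Definition ct_subbase : set (set (cotangent A)) :=
  [set U | exists i (V : set 'rV[R]_(n + n)),
     open V /\ U = ct_dom i `&` ct_coord i @^-1` V].

Fact zero_covector_subproof (p : M) :
  (forall i, ~ dom i p -> (0 : 'rV[R]_n) = 0) /\
  (forall i j, dom i p -> dom j p -> (0 : 'rV[R]_n) = 0 *m jac i j p).
Proof. by split=> // i j _ _; rewrite mul0mx. Qed.

Definition zero_covector (p : M) : cotangent A :=
  @Cotangent A p (fun=> 0) (zero_covector_subproof p).

(* [zero_covector _] is only a default value, for z outside of the image of
   [ct_coord i] on [ct_dom i]. *)
Definition ct_param i (z : 'rV[R]_(n + n)) : cotangent A :=
  xget (zero_covector (param i (lsubmx z)))
       [set q | ct_dom i q /\ ct_coord i q = z].

End Cotangent.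

HB.instance Definition _ (R : realType) (n : nat) (M : topologicalType)
    (A : atlas R n M) :=
  isSubBaseTopological.Build (cotangent A) (@ct_subbase R n M A) id.

Definition cotangent_atlas (R : realType) (n : nat) (M : topologicalType)
    (A : atlas R n M) : atlas R (n + n) (cotangent A) :=
  Atlas (@ct_dom R n M A) (@ct_coord R n M A) (@ct_param R n M A).

(* In this section J, g and G are components at one point of M in one chart.
   A vector X + xi is [col_mx X xi]. *)
Section NordenLift.
Context {R : realType} {n : nat}.
Implicit Types (J g : 'M[R]_n) (G : 'I_n -> 'M[R]_n) (u v : 'cV[R]_(n + n)).

Definition mx_of_map {m : nat} (f : 'cV[R]_m -> 'cV[R]_m) : 'M[R]_m :=
  \matrix_(a, b) f (delta_mx b 0) a 0.

Definition mx_of_form {m : nat} (h : 'cV[R]_m -> 'cV[R]_m -> R) : 'M[R]_m :=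
  \matrix_(a, b) h (delta_mx a 0) (delta_mx b 0).

(* flat(X)_b = g(X, d/dx^b) = X^a g_ab *)
Definition musical_flat g (X : 'cV[R]_n) : 'cV[R]_n := g^T *m X.
Definition musical_sharp g (xi : 'cV[R]_n) : 'cV[R]_n := invmx g^T *m xi.

(* J*(xi)_b = xi(J d/dx^b) = xi_a J^a_b *)
Definition Jstar J (xi : 'cV[R]_n) : 'cV[R]_n := J^T *m xi.

Definition Jhat J g u : 'cV[R]_(n + n) :=
  let X := usubmx u in let xi := dsubmx u in
  col_mx (J *m X) (musical_flat g X - Jstar J xi).

Definition ghat J g u v : R :=
  let X := usubmx u in let xi := dsubmx u in
  let Y := usubmx v in let eta := dsubmx v in
  form g X Y
  + 2^-1 * form g (J *m X) (musical_sharp g eta)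
  + 2^-1 * form g (musical_sharp g xi) (J *m Y)
  + form g (musical_sharp g xi) (musical_sharp g eta).

(* Matrix of Phi^nabla at the covector with components y, from the basis
   (d/dx^i, dx^j) to the basis (d/dx~^i, d/dy_j). *)
Definition Phi G (y : 'rV[R]_n) : 'M[R]_(n + n) :=
  block_mx 1%:M 0
           (\matrix_(l, i) \sum_(k < n) y 0 k * G i k l) 1%:M.

End NordenLift.

Section Transport.
Context {R : realType} {n : nat} {M : topologicalType} (A : atlas R n M).
Context (J g : tensor2 A) (G : christoffel A).

Definition Jtilde : tensor2 (cotangent_atlas A) := fun i q =>
  let P := Phi (G i (base q)) (comp q i) in
  mx_of_map (fun u =>
    P *m Jhat (J i (base q)) (g i (base q)) (invmx P *m u)).

Definition gtilde : tensor2 (cotangent_atlas A) := fun i q =>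
  let P := Phi (G i (base q)) (comp q i) in
  mx_of_form (fun u v =>
    ghat (J i (base q)) (g i (base q)) (invmx P *m u) (invmx P *m v)).

End Transport.

(* Main.v *)
Require Import Defs.
From mathcomp Require Import all_boot all_order all_algebra.
From mathcomp Require Import all_classical all_reals all_analysis.
From mathcomp Require Import ring lra.
Import Order.TTheory GRing.Theory Num.Theory numFieldNormedType.Exports.
Import Defs.

Set Implicit Arguments.
Unset Strict Implicit.
Unset Printing Implicit Defensive.

Local Open Scope classical_set_scope.
Local Open Scope ring_scope.

(** The horizontal and vertical lifts defined by the connection form a frame of
    the tangent bundle of the cotangent bundle, given in the coordinates
    (x~, y) by the block matrix P = [1 0; S 1] with S = y Gamma.  Between two
    charts this frame changes by the block diagonal matrix
    D = diag(jac, jac^-T) (lemma [jac_lift_frame]; this is the transformation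
    law of the Christoffel symbols).  In this frame the lifted structures have
    the components

      [J 0; g^T -J^T]   and   [g J^T/2; J/2 g^-1],

    which depend on the base point only, and all the pointwise conditions of a
    Norden manifold reduce to block matrix identities ([Jhat_mx_sq],
    [ghat_mx_unit], [Jhat_ghat_adjoint]).

    The Levi-Civita connection of the lifted metric is the one whose connection
    matrices in this frame are diag(Gamma_a, -Gamma_a^T) in the direction of
    x~^a and 0 in the direction of the fibres: the given connection on
    horizontal vectors, its dual on vertical ones ([lift_connection]).  Gauge
    transformation by P gives its Christoffel symbols P W P^-1 - dP P^-1, and
    the formulas for covariant derivatives and curvature in a moving frame
    ([nabla_endo_frame], [nabla_form_frame], [curvature_frame]) show that

    - the lifted metric is parallel because J and g are
      ([ghat_mx_parallel]), and so is the lifted almost complex structure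
      ([Jhat_mx_parallel]);
    - the curvature is diag(R, -R^T) = 0;
    - the torsion vanishes, because the bracket of two horizontal lifts is the
      vertical field given by the curvature R = 0
      ([lift_connection_base_sym]).

    The curvature formula uses the symmetry of second derivatives of P
    ([partialC]).  The hypotheses provide some Levi-Civita connection for which
    J is parallel and some Levi-Civita connection which is flat; both
    coincide with the given one by [levi_civita_unique].

    What remains is that the cotangent bundle is a smooth manifold
    ([cotangent_smooth_manifold]): its charts are homeomorphisms onto open sets
    for the topology generated by the charts, the transition maps are the pairs
    of a transition of the base and a Jacobian matrix acting on covectors, and
    a countable basis is obtained by choosing one chart for each element of a
    countable basis of the base. *)

(** * Partial derivatives and smooth functions on R^n *)

Section PartialDerivatives.
Context {R : realType}.

(** Differentiability is a local property. *)
Lemma near_eq_differentiable (V W : normedModType R) (f g : V -> W) (x : V) :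
  (\near x, f x = g x) -> differentiable f x -> differentiable g x.
Proof.
move=> fg /diff_locallyP[dfc].
have fgx : f x = g x by exact: nbhs_singleton fg.
move=> dfE.
have gE : g \o shift x = cst (g x) + 'd f x +o_ 0 id.
  apply/eqaddoP => e e0; move/eqaddoP : (dfE) => /(_ e e0) H.
  have fg0 : \forall y \near (0 : V), f (y + x) = g (y + x).
    have : (fun y : V => y + x) @ (0 : V) --> x.
      rewrite -[X in _ --> X]add0r; apply: cvgD; [exact: cvg_id|exact: cvg_cst].
    by move/(_ _ fg).
  near=> y; rewrite /= !fctE /= -(near fg0 y) // -fgx.
  by near: y; exact: H.
by apply/diff_locallyP; rewrite (diff_unique dfc gE).
Unshelve. all: by end_near. Qed.

Context {n : nat}.
Implicit Types (f g : 'rV[R]_n -> R) (x : 'rV[R]_n) (a : 'I_n).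

Lemma partialE a f x : differentiable f x -> partial a f x = 'd f x (delta_mx 0 a).
Proof. by move=> df; rewrite /partial deriveE. Qed.

Lemma near_eq_partial a f g x :
  (\near x, f x = g x) -> partial a f x = partial a g x.
Proof. exact: near_eq_derive. Qed.

Lemma partialD a f g x : differentiable f x -> differentiable g x ->
  partial a (fun y => f y + g y) x = partial a f x + partial a g x.
Proof. by move=> df dg; apply: deriveD; exact: diff_derivable. Qed.

Lemma partialM a f g x : differentiable f x -> differentiable g x ->
  partial a (fun y => f y * g y) x = partial a f x * g x + f x * partial a g x.
Proof.
move=> df dg; rewrite /partial [LHS]deriveM; try exact: diff_derivable.
by rewrite addrC /GRing.scale /= [g x * _]mulrC.
Qed.

Lemma partial_cst a (c : R) x : partial a (fun=> c) x = 0.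
Proof. exact: derive_cst. Qed.

Lemma partialV a f x : differentiable f x -> f x != 0 ->
  partial a (fun y => (f y)^-1) x = - ((f x)^-1 * (f x)^-1 * partial a f x).
Proof.
move=> df fx0; rewrite /partial [LHS]deriveV //; last exact: diff_derivable.
by rewrite /GRing.scale /= mulNr expr2 invfM.
Qed.

End PartialDerivatives.

Section ChainRule.
Context {R : realType} {m n : nat}.
Implicit Types (f : 'rV[R]_m -> R) (phi : 'rV[R]_n -> 'rV[R]_m) (x : 'rV[R]_n).

Lemma differentiable_row phi x :
  (forall b, differentiable (fun y => phi y 0 b) x) -> differentiable phi x.
Proof.
move=> dphi.
rewrite (_ : phi = \sum_(b < m) (fun y => phi y 0 b *: delta_mx 0 b)).
  by apply: differentiable_sum => b; apply: differentiableZl.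
apply/funext => y; rewrite fct_sumE; apply/rowP => c; rewrite summxE.
rewrite (bigD1 c) //= big1 ?addr0; first by rewrite !mxE !eqxx mulr1.
by move=> b bc; rewrite !mxE eqxx eq_sym (negbTE bc) mulr0.
Qed.

Lemma differentiable_comp_row f phi x :
  (forall b, differentiable (fun y => phi y 0 b) x) ->
  differentiable f (phi x) -> differentiable (fun y => f (phi y)) x.
Proof. by move=> /differentiable_row dphi df; exact: differentiable_comp. Qed.

(** Chain rule. *)
Lemma partial_comp a f phi x :
  (forall b, differentiable (fun y => phi y 0 b) x) ->
  differentiable f (phi x) ->
  partial a (fun y => f (phi y)) x =
    \sum_b partial b f (phi x) * partial a (fun y => phi y 0 b) x.
Proof.
move=> dphi df; have dp := differentiable_row dphi.
rewrite partialE; last exact: differentiable_comp.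
rewrite [X in X _ = _](diff_comp dp df) /= -(deriveE _ dp).
rewrite derive_mx; last exact: diff_derivable.
set v := \matrix_(_, _) _.
have -> : v = \sum_b v 0 b *: delta_mx 0 b by exact: row_sum_delta.
rewrite linear_sum; apply: eq_bigr => b _.
by rewrite linearZ /= -partialE // mxE mulrC.
Qed.

End ChainRule.

Section Smoothness.
Context {R : realType}.

Lemma CkW n k (D : set 'rV[R]_n) f : Ck k.+1 D f -> Ck k D f.
Proof.
elim: k f => [|k ih] f.
  by case=> df _ x Dx; exact/differentiable_continuous/df.
by case=> df pf; split=> // a; apply: ih; exact: pf.
Qed.

Section OpenDomain.
Context {n : nat} (D : set 'rV[R]_n).
Hypothesis oD : open D.
Implicit Types (f g : 'rV[R]_n -> R).

Lemma open_near_eq f g x : (forall y, D y -> f y = g y) -> D x ->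
  \near x, f x = g x.
Proof. by move=> fg Dx; near=> y; apply: fg; near: y; exact: open_nbhs_nbhs. 
Unshelve. all: by end_near. Qed.

Lemma Ck_eq k f g : (forall x, D x -> f x = g x) -> Ck k D f -> Ck k D g.
Proof.
elim: k f g => [|k ih] f g fg /=.
  move=> cf x Dx; rewrite /prop_for /continuous_at -(fg _ Dx).
  by apply: cvg_trans (cf _ Dx); exact: near_eq_cvg (open_near_eq fg Dx).
case=> df pf; split=> [x Dx|a].
  by apply: near_eq_differentiable (df _ Dx); exact: open_near_eq.
apply: ih (pf a) => x Dx.
by apply: near_eq_partial; exact: open_near_eq.
Qed.

Lemma Ck_cst k (c : R) : Ck k D (fun=> c).
Proof.
elim: k c => [|k ih] c /=; first by move=> x _; exact: cst_continuous.
split=> [x _|a]; first exact: differentiable_cst.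
by apply: Ck_eq (ih 0) => x _; rewrite partial_cst.
Qed.

Lemma CkD k f g : Ck k D f -> Ck k D g -> Ck k D (fun x => f x + g x).
Proof.
elim: k f g => [|k ih] f g /=.
  by move=> cf cg x Dx; apply: continuousD; [exact: cf|exact: cg].
case=> df pf [dg pg]; split=> [x Dx|a].
  by apply: differentiableD; [exact: df|exact: dg].
apply: Ck_eq (ih _ _ (pf a) (pg a)) => x Dx.
by rewrite partialD; [|exact: df|exact: dg].
Qed.

Lemma CkM k f g : Ck k D f -> Ck k D g -> Ck k D (fun x => f x * g x).
Proof.
elim: k f g => [|k ih] f g /=.
  by move=> cf cg x Dx; apply: continuousM; [exact: cf|exact: cg].
move=> Cf Cg; case: (Cf) => df pf; case: (Cg) => dg pg; split=> [x Dx|a].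
  by apply: differentiableM; [exact: df|exact: dg].
apply: (@Ck_eq _ (fun x => partial a f x * g x + f x * partial a g x)).
  by move=> x Dx; rewrite partialM; [|exact: df|exact: dg].
by apply: CkD; apply: ih; [exact: pf|exact: CkW|exact: CkW|exact: pg].
Qed.

Lemma CkV k f : (forall x, D x -> f x != 0) -> Ck k D f ->
  Ck k D (fun x => (f x)^-1).
Proof.
move=> f0; elim: k => [|k ih] /=.
  by move=> cf x Dx; apply: continuousV; [exact: f0|exact: cf].
move=> Cf; case: (Cf) => df pf; split=> [x Dx|a].
  by apply: differentiableV; [exact: df|exact: f0].
apply: (@Ck_eq _ (fun x => (-1) * ((f x)^-1 * (f x)^-1 * partial a f x))).
  by move=> x Dx; rewrite partialV ?mulN1r //; [exact: df|exact: f0].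
have Cfk : Ck k D (fun x => (f x)^-1) by apply: ih; exact: CkW.
by apply: CkM (CkM (CkM _ _) (pf a)) => //; exact: Ck_cst.
Qed.

Lemma Ck_sum k (I : Type) (r : seq I) (F : I -> 'rV[R]_n -> R) :
  (forall i, Ck k D (F i)) -> Ck k D (fun x => \sum_(i <- r) F i x).
Proof.
move=> CF; elim: r => [|i r ih].
  by apply: Ck_eq (Ck_cst k 0) => x _; rewrite big_nil.
by apply: Ck_eq (CkD (CF i) ih) => x _; rewrite big_cons.
Qed.

Lemma Ck_prod k (I : Type) (r : seq I) (F : I -> 'rV[R]_n -> R) :
  (forall i, Ck k D (F i)) -> Ck k D (fun x => \prod_(i <- r) F i x).
Proof.
move=> CF; elim: r => [|i r ih].
  by apply: Ck_eq (Ck_cst k 1) => x _; rewrite big_nil.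
by apply: Ck_eq (CkM (CF i) ih) => x _; rewrite big_cons.
Qed.

Lemma Ck_coord k (c : 'I_n) : Ck k D (fun x => x 0 c).
Proof.
case: k => [|k] /=; first by move=> x _; exact: coord_continuous.
split=> [x _|a]; first exact: differentiable_coord.
apply: Ck_eq (Ck_cst k ((delta_mx 0 a : 'rV[R]_n) 0 c)) => x _.
rewrite /partial.
transitivity (('D_(delta_mx 0 a) (@id 'rV[R]_n) x) 0 c); first by rewrite derive_id.
by rewrite derive_mx ?mxE //; exact: derivable_id.
Qed.

End OpenDomain.

Lemma continuous_row (T : topologicalType) m (phi : T -> 'rV[R]_m) (x : T) :
  (forall b, {for x, continuous (fun y => phi y 0 b)}) ->
  {for x, continuous phi}.
Proof.
move=> cphi; apply/cvgrPdist_le => e e0; near=> y.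
rewrite [leLHS]/Num.Def.normr/= mx_normrE (bigmax_le _ (ltW e0))//= => -[i j] _.
rewrite ord1 !mxE /=; move: j; near: y; apply: filter_forall => j.
by have /cvgrPdist_le/(_ _ e0) := cphi j.
Unshelve. all: by end_near. Qed.

(** Smoothness of a composite, by induction on the order with the chain rule. *)
Lemma Ck_comp m n k (D : set 'rV[R]_n) (E : set 'rV[R]_m)
    (f : 'rV[R]_m -> R) (phi : 'rV[R]_n -> 'rV[R]_m) :
  open D -> (forall x, D x -> E (phi x)) ->
  Ck k E f -> (forall b, Ck k D (fun x => phi x 0 b)) ->
  Ck k D (fun x => f (phi x)).
Proof.
move=> oD DE; elim: k f => [|k ih] f /=.
  move=> cf cphi x Dx; apply: (@continuous_comp _ _ _ phi f); last exact/cf/DE.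
  by apply: continuous_row => b; exact: cphi.
move=> Cf Cphi.
case: (Cf) => df pf; have dphi x b : D x -> differentiable (fun y => phi y 0 b) x.
  by move=> Dx; have [+ _] := Cphi b; apply.
split=> [x Dx|a].
  by apply: differentiable_comp_row => [b|]; [exact: dphi|exact/df/DE].
apply: (@Ck_eq n _ oD k
  (fun x => \sum_b partial b f (phi x) * partial a (fun y => phi y 0 b) x)).
  by move=> x Dx; rewrite partial_comp // => [b|]; [exact: dphi|exact/df/DE].
apply: Ck_sum => // b; apply: CkM => //; last by have [_] := Cphi b; apply.
by apply: ih => // b'; exact: CkW.
Qed.

End Smoothness.

(** * Symmetry of second partial derivatives *)

Section Schwarz.
Context {R : realType} {n : nat}.
Implicit Types (f : 'rV[R]_n -> R) (x y v w : 'rV[R]_n).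

Lemma is_derive_line f y v (s : R) : derivable f (y + s *: v) v ->
  is_derive s 1 (fun t : R => f (y + t *: v)) ('D_v f (y + s *: v)).
Proof.
have E : (fun h : R => h^-1 *: (((fun t : R => f (y + t *: v)) \o shift s) (h *: 1)
     - f (y + s *: v))) =
  (fun h : R => h^-1 *: ((f \o shift (y + s *: v)) (h *: v) - f (y + s *: v))).
  apply/funext => h /=; congr (_ *: (f _ - _)).
  have -> : h *: (1 : R) = h by exact: mulr1.
  by rewrite scalerDl addrCA.
by move=> df; split; rewrite /derivable /derive E.
Qed.

Lemma mean_value_line f y v (h : R) : 0 < h ->
  (forall s, 0 <= s <= h -> derivable f (y + s *: v) v) ->
  exists2 c, 0 < c < h & f (y + h *: v) - f y = 'D_v f (y + c *: v) * h.
Proof.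
move=> h0 df; pose g t := f (y + t *: v).
have dg s : 0 <= s <= h -> is_derive s 1 g ('D_v f (y + s *: v)).
  by move=> /df; exact: is_derive_line.
have [||c ch E] := @MVT R g (fun s => 'D_v f (y + s *: v)) 0 h h0.
- move=> s; rewrite in_itv /= => /andP[s0 sh].
  by apply: dg; rewrite !ltW.
- apply: derivable_within_continuous => s; rewrite in_itv /= => sh.
  by have [] := dg _ sh.
exists c; first by move: ch; rewrite in_itv.
by move: E; rewrite /g scale0r addr0 subr0.
Qed.

(** Second difference of [f] at [x] along the parallelogram spanned by [h v] and
    [h w]; it is symmetric in [v] and [w]. *)
Definition second_difference f x v w (h : R) : R :=
  f (x + h *: v + h *: w) - f (x + h *: v) - f (x + h *: w) + f x.

Lemma second_differenceC f x v w h :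
  second_difference f x v w h = second_difference f x w v h.
Proof. by rewrite /second_difference [x + _ + _]addrAC; lra. Qed.

(** The mean value theorem applied first to y |-> f (y + h w) - f y in the
    direction of [v], then to the derivative of [f] along [v] in the direction
    of [w]. *)
Lemma second_difference_mean_value f x v w (D : set 'rV[R]_n) (h : R) : 0 < h ->
  (forall s t, 0 <= s <= h -> 0 <= t <= h -> D (x + s *: v + t *: w)) ->
  (forall y, D y -> derivable f y v) ->
  (forall y, D y -> derivable ('D_v f) y w) ->
  exists c d, [/\ 0 < c < h, 0 < d < h &
    second_difference f x v w h = 'D_w ('D_v f) (x + c *: v + d *: w) * h ^+ 2].
Proof.
move=> h0 hD df ddf.
have hh : 0 <= h <= h by rewrite ltW /=.
have h00 : 0 <= (0 : R) <= h by rewrite lexx ltW.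
pose f1 y := f (y + h *: w) - f y.
have df1 s : 0 <= s <= h -> is_derive (x + s *: v) v f1
    ('D_v f (x + s *: v + h *: w) - 'D_v f (x + s *: v)).
  move=> sh; apply: is_deriveB.
    have Dd := df _ (hD _ _ sh hh).
    have E : (fun k : R => k^-1 *:
       (((fun y => f (y + h *: w)) \o shift (x + s *: v)) (k *: v)
       - f (x + s *: v + h *: w))) =
      (fun k : R => k^-1 *: ((f \o shift (x + s *: v + h *: w)) (k *: v)
       - f (x + s *: v + h *: w))).
      by apply/funext => k /=; rewrite !addrA.
    by split; [rewrite /derivable E; exact: Dd|rewrite /derive E].
  apply: derivableP; have := df _ (hD _ _ sh h00).
  by rewrite scale0r addr0.
have [|c ch Ec] := @mean_value_line f1 x v h h0.
  by move=> s /df1[].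
have ch' : 0 <= c <= h by case/andP: ch => *; rewrite !ltW.
have [|d dh Ed] := @mean_value_line ('D_v f) (x + c *: v) w h h0.
  by move=> t th; apply: ddf; exact: hD.
exists c, d; split => //.
have -> : second_difference f x v w h = f1 (x + h *: v) - f1 x.
  by rewrite /second_difference /f1; lra.
have [_ Edf1] := df1 _ ch'.
by rewrite Ec Edf1 Ed expr2 mulrA.
Qed.

(** Symmetry of second partial derivatives: both mixed derivatives are limits
    of the same second difference quotient. *)
Lemma partialC f (D : set 'rV[R]_n) (a b : 'I_n) x : open D -> Ck 2 D f -> D x ->
  partial a (partial b f) x = partial b (partial a f) x.
Proof.
move=> oD C2 Dx.
suff H (c d : 'I_n) (e : R) : 0 < e -> \forall h \near (0 : R)^'+,
    `|second_difference f x (delta_mx 0 c) (delta_mx 0 d) h / h ^+ 2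
      - partial d (partial c f) x| <= e.
  apply/eqP; rewrite -subr_eq0 -normr_le0; apply/ler_addgt0Pr => e e0; rewrite add0r.
  have e2 : 0 < e / 2 by rewrite divr_gt0.
  have [h [H1 H2]] := @filter_ex _ (0 : R)^'+ _ _ (filterI (H b a _ e2) (H a b _ e2)).
  rewrite second_differenceC in H1.
  move: H1 H2; move: (_ / _) (partial a _ x) (partial b _ x) => q A B H1 H2.
  have -> : A - B = (q - B) - (q - A) by lra.
  by rewrite (le_trans (ler_normB _ _)) // [leRHS]splitr lerD.
move=> e0.
set v := delta_mx 0 c; set w := delta_mx 0 d.
have [df pf] := C2; have [dpf ppf] := pf c.
have ct := ppf d; have {ct} /cvgrPdist_le/(_ _ e0) ct := ct _ Dx.
have : \forall y \near x,
    D y /\ `|partial d (partial c f) x - partial d (partial c f) y| <= e.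
  by apply: filterI; [exact: open_nbhs_nbhs|exact: ct].
case/nbhs_normP => r /= r0 rP.
pose K := `|v| + `|w| + 1.
have K0 : 0 < K by rewrite /K ltr_wpDl // addr_ge0.
have rK : 0 < r / K by rewrite divr_gt0.
near=> h.
have h0 : 0 < h by near: h; exact: nbhs_right_gt.
have hr : h < r / K by near: h; exact: nbhs_right_lt.
have inball s t : 0 <= s <= h -> 0 <= t <= h ->
    `|x - (x + s *: v + t *: w)| < r.
  move=> /andP[s0 sh] /andP[t0 th].
  rewrite -addrA opprD addrA subrr sub0r normrN.
  rewrite (le_lt_trans (ler_normD _ _)) // !normrZ !ger0_norm //.
  rewrite ltr_pdivlMr // in hr; apply: le_lt_trans hr.
  rewrite /K mulrDr mulr1 mulrDr; apply: ler_wpDr; first exact: ltW.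
  by rewrite lerD // ler_wpM2r.
have [|||c' [d' [ch dh E]]] :=
  @second_difference_mean_value f x v w D h h0.
- by move=> s t sh th; have [] := rP _ (inball _ _ sh th).
- by move=> y /df; exact: diff_derivable.
- by move=> y /dpf; exact: diff_derivable.
rewrite E mulfK ?expf_neq0 ?gt_eqF // distrC.
case/andP: ch => c1 c2; case/andP: dh => d1 d2.
by have [|_] := rP (x + c' *: v + d' *: w) _; first by apply: inball; rewrite !ltW.
Unshelve. all: by end_near. Qed.

End Schwarz.

(** * Matrix valued functions *)

Section MatrixFields.
Context {R : realType} {n : nat}.
Implicit Types (x : 'rV[R]_n) (a : 'I_n).

(** Entrywise partial derivative of a matrix valued function. *)
Definition mxpartial p q a (F : 'rV[R]_n -> 'M[R]_(p, q)) x : 'M[R]_(p, q) :=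
  \matrix_(b, c) partial a (fun y => F y b c) x.

(** Entrywise differentiability of a matrix valued function at a point. *)
Definition mxdiff p q (F : 'rV[R]_n -> 'M[R]_(p, q)) x : Prop :=
  forall b c, differentiable (fun y => F y b c) x.

(** Entrywise smoothness of a matrix valued function on a set. *)
Definition mxsmooth p q (D : set 'rV[R]_n) (F : 'rV[R]_n -> 'M[R]_(p, q)) :=
  forall b c, smooth_on D (fun y => F y b c).

Lemma near_eq_mxpartial p q a (F G : 'rV[R]_n -> 'M[R]_(p, q)) x :
  (\near x, F x = G x) -> mxpartial a F x = mxpartial a G x.
Proof.
move=> FG; apply/matrixP => b c; rewrite !mxE; apply: near_eq_partial.
by apply: filterS FG => y ->.
Qed.

Lemma near_eq_mxdiff p q (F G : 'rV[R]_n -> 'M[R]_(p, q)) x :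
  (\near x, F x = G x) -> mxdiff F x -> mxdiff G x.
Proof.
move=> FG dF b c; apply: near_eq_differentiable (dF b c).
by apply: filterS FG => y ->.
Qed.

Lemma mxdiff_continuous p (F : 'rV[R]_n -> 'rV[R]_p) x :
  mxdiff F x -> {for x, continuous F}.
Proof. by move=> dF; apply: continuous_row => b; exact: differentiable_continuous. Qed.

Lemma mxpartial_cst p q a (A : 'M[R]_(p, q)) x : mxpartial a (fun=> A) x = 0.
Proof. by apply/matrixP => b c; rewrite !mxE partial_cst. Qed.

Lemma mxdiff_cst p q (A : 'M[R]_(p, q)) x : mxdiff (fun=> A) x.
Proof. by move=> b c; exact: differentiable_cst. Qed.

Lemma mxpartial_tr p q a (F : 'rV[R]_n -> 'M[R]_(p, q)) x :
  mxpartial a (fun y => (F y)^T) x = (mxpartial a F x)^T.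
Proof.
apply/matrixP => b c; rewrite !mxE; congr (partial a _ x).
by apply/funext => y; rewrite mxE.
Qed.

Lemma mxdiff_tr p q (F : 'rV[R]_n -> 'M[R]_(p, q)) x :
  mxdiff F x -> mxdiff (fun y => (F y)^T) x.
Proof.
move=> dF b c; rewrite (_ : (fun _ => _) = fun y => F y c b) //.
by apply/funext => y; rewrite mxE.
Qed.

Lemma mxpartialD p q a (F G : 'rV[R]_n -> 'M[R]_(p, q)) x :
  mxdiff F x -> mxdiff G x ->
  mxpartial a (fun y => F y + G y) x = mxpartial a F x + mxpartial a G x.
Proof.
move=> dF dG; apply/matrixP => b c; rewrite !mxE -partialD //; congr (partial a _ x).
by apply/funext => y; rewrite mxE.
Qed.

Lemma differentiable_sum_fun (I : Type) (r : seq I) (F : I -> 'rV[R]_n -> R) x :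
  (forall i, differentiable (F i) x) ->
  differentiable (fun y => \sum_(i <- r) F i y) x.
Proof.
move=> dF; elim: r => [|i r ih].
  rewrite (_ : (fun _ => _) = fun=> 0); first exact: differentiable_cst.
  by apply/funext => y; rewrite big_nil.
rewrite (_ : (fun _ => _) = fun y => F i y + \sum_(i <- r) F i y).
  exact: differentiableD.
by apply/funext => y; rewrite big_cons.
Qed.

Lemma partial_sum (I : Type) (r : seq I) a (F : I -> 'rV[R]_n -> R) x :
  (forall i, differentiable (F i) x) ->
  partial a (fun y => \sum_(i <- r) F i y) x = \sum_(i <- r) partial a (F i) x.
Proof.
move=> dF; elim: r => [|i r ih].
  rewrite big_nil -[RHS](partial_cst a 0 x); congr (partial a _ x).
  by apply/funext => y; rewrite big_nil.
rewrite big_cons -ih -partialD //; last exact: differentiable_sum_fun.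
by congr (partial a _ x); apply/funext => y; rewrite big_cons.
Qed.

Lemma mxdiffM p q r (F : 'rV[R]_n -> 'M[R]_(p, q))
    (G : 'rV[R]_n -> 'M[R]_(q, r)) x :
  mxdiff F x -> mxdiff G x -> mxdiff (fun y => F y *m G y) x.
Proof.
move=> dF dG b c; rewrite (_ : (fun _ => _) = fun y => \sum_k F y b k * G y k c).
  by apply: differentiable_sum_fun => k; apply: differentiableM.
by apply/funext => y; rewrite mxE.
Qed.

Lemma mxpartialM p q r a (F : 'rV[R]_n -> 'M[R]_(p, q))
    (G : 'rV[R]_n -> 'M[R]_(q, r)) x : mxdiff F x -> mxdiff G x ->
  mxpartial a (fun y => F y *m G y) x =
    mxpartial a F x *m G x + F x *m mxpartial a G x.
Proof.
move=> dF dG; apply/matrixP => b c; rewrite !mxE.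
transitivity (partial a (fun y => \sum_k F y b k * G y k c) x).
  by congr (partial a _ x); apply/funext => y; rewrite mxE.
rewrite partial_sum; last by move=> k; apply: differentiableM.
rewrite -big_split; apply: eq_bigr => k _ /=.
by rewrite partialM // !mxE.
Qed.

Lemma mxpartialMl p q r a (A : 'M[R]_(p, q)) (G : 'rV[R]_n -> 'M[R]_(q, r)) x :
  mxdiff G x -> mxpartial a (fun y => A *m G y) x = A *m mxpartial a G x.
Proof.
move=> dG; by rewrite mxpartialM // mxpartial_cst mul0mx add0r.
Qed.

Lemma mxpartialN p q a (F : 'rV[R]_n -> 'M[R]_(p, q)) x :
  mxdiff F x -> mxpartial a (fun y => - F y) x = - mxpartial a F x.
Proof.
move=> dF; transitivity (mxpartial a (fun y => (- 1%:M) *m F y) x).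
  by apply: near_eq_mxpartial; near=> y; rewrite mulNmx mul1mx.
by rewrite mxpartialMl // mulNmx mul1mx.
Unshelve. all: by end_near. Qed.

Lemma mxdiffN p q (F : 'rV[R]_n -> 'M[R]_(p, q)) x :
  mxdiff F x -> mxdiff (fun y => - F y) x.
Proof.
move=> dF; apply: (@near_eq_mxdiff _ _ (fun y => (- 1%:M) *m F y)).
  by near=> y; rewrite mulNmx mul1mx.
by apply: mxdiffM => //; exact: mxdiff_cst.
Unshelve. all: by end_near. Qed.

Lemma mxpartialB p q a (F G : 'rV[R]_n -> 'M[R]_(p, q)) x :
  mxdiff F x -> mxdiff G x ->
  mxpartial a (fun y => F y - G y) x = mxpartial a F x - mxpartial a G x.
Proof. by move=> dF dG; rewrite mxpartialD ?mxpartialN //; exact: mxdiffN. Qed.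

Lemma mxpartial_block p q r s a (A : 'rV[R]_n -> 'M[R]_(p, q))
   (B : 'rV[R]_n -> 'M[R]_(p, r)) (C : 'rV[R]_n -> 'M[R]_(s, q))
   (D : 'rV[R]_n -> 'M[R]_(s, r)) x :
  mxpartial a (fun y => block_mx (A y) (B y) (C y) (D y)) x =
  block_mx (mxpartial a A x) (mxpartial a B x) (mxpartial a C x) (mxpartial a D x).
Proof.
apply/matrixP => b c; rewrite -[b]splitK -[c]splitK mxE.
by case: (fintype.split b) => b'; case: (fintype.split c) => c' /=;
  rewrite ?(block_mxEul, block_mxEur, block_mxEdl, block_mxEdr) mxE;
  congr (partial a _ x); apply/funext => y;
  rewrite ?(block_mxEul, block_mxEur, block_mxEdl, block_mxEdr).
Qed.

(** The derivative of an inverse, from the derivative of a product. *)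
Lemma mxpartial_inv p a (F G : 'rV[R]_n -> 'M[R]_p) x :
  (\near x, F x *m G x = 1%:M) -> mxdiff F x -> mxdiff G x ->
  mxpartial a G x = - (G x *m mxpartial a F x *m G x).
Proof.
move=> FG dF dG.
have := mxpartialM a dF dG.
rewrite (near_eq_mxpartial a FG) mxpartial_cst => /esym/eqP.
rewrite addrC addr_eq0 => /eqP E.
have GF : G x *m F x = 1%:M by apply: mulmx1C; exact: nbhs_singleton FG.
by rewrite -[LHS]mul1mx -GF -mulmxA E mulmxN mulmxA.
Qed.

End MatrixFields.

Section MatrixSmooth.
Context {R : realType} {n : nat} (D : set 'rV[R]_n).
Hypothesis oD : open D.

Lemma smooth_on_eq f g : (forall x, D x -> f x = g x) ->
  smooth_on D f -> smooth_on D g.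
Proof. by move=> fg Cf k; exact: (Ck_eq oD fg). Qed.

Lemma smooth_onM f g : smooth_on D f -> smooth_on D g ->
  smooth_on D (fun x => f x * g x).
Proof. by move=> Cf Cg k; exact: CkM. Qed.

Lemma mxsmooth_eq p q (F G : 'rV[R]_n -> 'M[R]_(p, q)) :
  (forall x, D x -> F x = G x) -> mxsmooth D F -> mxsmooth D G.
Proof. by move=> FG CF b c; apply: smooth_on_eq (CF b c) => x /FG ->. Qed.

Lemma mxsmooth_mxdiff p q (F : 'rV[R]_n -> 'M[R]_(p, q)) x :
  mxsmooth D F -> D x -> mxdiff F x.
Proof. by move=> CF Dx b c; have [+ _] := CF b c 1%N; apply. Qed.

Lemma mxsmooth_cst p q (A : 'M[R]_(p, q)) : mxsmooth D (fun=> A).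
Proof. by move=> b c k; exact: Ck_cst. Qed.

Lemma mxsmoothD p q (F G : 'rV[R]_n -> 'M[R]_(p, q)) :
  mxsmooth D F -> mxsmooth D G -> mxsmooth D (fun x => F x + G x).
Proof.
move=> CF CG b c; apply: (@smooth_on_eq (fun x => F x b c + G x b c)).
  by move=> x _; rewrite mxE.
by move=> k; apply: CkD => //; [exact: CF|exact: CG].
Qed.

Lemma mxsmoothM p q r (F : 'rV[R]_n -> 'M[R]_(p, q))
    (G : 'rV[R]_n -> 'M[R]_(q, r)) :
  mxsmooth D F -> mxsmooth D G -> mxsmooth D (fun x => F x *m G x).
Proof.
move=> CF CG b c; apply: (@smooth_on_eq (fun x => \sum_k F x b k * G x k c)).
  by move=> x _; rewrite mxE.
by move=> k; apply: Ck_sum => // j; apply: CkM => //; [exact: CF|exact: CG].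
Qed.

Lemma mxsmoothN p q (F : 'rV[R]_n -> 'M[R]_(p, q)) :
  mxsmooth D F -> mxsmooth D (fun x => - F x).
Proof.
move=> CF; apply: (@mxsmooth_eq _ _ (fun x => (- 1%:M) *m F x)).
  by move=> x _; rewrite mulNmx mul1mx.
by apply: mxsmoothM => //; exact: mxsmooth_cst.
Qed.

Lemma mxsmoothB p q (F G : 'rV[R]_n -> 'M[R]_(p, q)) :
  mxsmooth D F -> mxsmooth D G -> mxsmooth D (fun x => F x - G x).
Proof. by move=> CF CG; apply: mxsmoothD => //; exact: mxsmoothN. Qed.

Lemma mxsmooth_tr p q (F : 'rV[R]_n -> 'M[R]_(p, q)) :
  mxsmooth D F -> mxsmooth D (fun x => (F x)^T).
Proof.
by move=> CF b c; apply: smooth_on_eq (CF c b) => x _; rewrite mxE.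
Qed.

Lemma mxsmooth_block p q r s (F1 : 'rV[R]_n -> 'M[R]_(p, q))
   (F2 : 'rV[R]_n -> 'M[R]_(p, r)) (F3 : 'rV[R]_n -> 'M[R]_(s, q))
   (F4 : 'rV[R]_n -> 'M[R]_(s, r)) :
  mxsmooth D F1 -> mxsmooth D F2 -> mxsmooth D F3 -> mxsmooth D F4 ->
  mxsmooth D (fun y => block_mx (F1 y) (F2 y) (F3 y) (F4 y)).
Proof.
move=> C1 C2 C3 C4 b c; rewrite -[b]splitK -[c]splitK.
case: (fintype.split b) => b'; case: (fintype.split c) => c' /=.
- by apply: smooth_on_eq (C1 b' c') => x _; rewrite block_mxEul.
- by apply: smooth_on_eq (C2 b' c') => x _; rewrite block_mxEur.
- by apply: smooth_on_eq (C3 b' c') => x _; rewrite block_mxEdl.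
- by apply: smooth_on_eq (C4 b' c') => x _; rewrite block_mxEdr.
Qed.

Lemma mxsmooth_row p q r (F : 'rV[R]_n -> 'M[R]_(p, q))
    (G : 'rV[R]_n -> 'M[R]_(p, r)) :
  mxsmooth D F -> mxsmooth D G -> mxsmooth D (fun x => row_mx (F x) (G x)).
Proof.
move=> CF CG b c; rewrite -[c]splitK; case: (fintype.split c) => c' /=.
- by apply: smooth_on_eq (CF b c') => x _; rewrite row_mxEl.
- by apply: smooth_on_eq (CG b c') => x _; rewrite row_mxEr.
Qed.

Lemma mxsmooth_partial p q a (F : 'rV[R]_n -> 'M[R]_(p, q)) :
  mxsmooth D F -> mxsmooth D (mxpartial a F).
Proof.
move=> CF b c; apply: (@smooth_on_eq (partial a (fun y => F y b c))).
  by move=> x _; rewrite mxE.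
by move=> k; have [_] := CF b c k.+1; apply.
Qed.

(** Smoothness of the determinant, by its Leibniz expansion. *)
Lemma smooth_on_det p (F : 'rV[R]_n -> 'M[R]_p) :
  mxsmooth D F -> smooth_on D (fun x => \det (F x)).
Proof.
move=> CF k; apply: Ck_sum => // s; apply: CkM => //; first exact: Ck_cst.
by apply: Ck_prod => // i; exact: CF.
Qed.

(** Smoothness of the inverse matrix, by its expression with cofactors. *)
Lemma mxsmooth_inv p (F : 'rV[R]_n -> 'M[R]_p) :
  (forall x, D x -> F x \in unitmx) -> mxsmooth D F ->
  mxsmooth D (fun x => invmx (F x)).
Proof.
move=> uF CF b c.
apply: (@smooth_on_eq (fun x => (\det (F x))^-1 *
    ((-1) ^+ (c + b) * \det (row' c (col' b (F x)))))).
  by move=> x Dx; rewrite /invmx uF // !mxE.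
apply: smooth_onM.
  move=> k; apply: CkV => //; last exact: smooth_on_det.
  by move=> x /uF; rewrite unitmxE unitfE.
apply: smooth_onM; first by move=> k; exact: Ck_cst.
apply: smooth_on_det => i j.
by apply: smooth_on_eq (CF (lift c i) (lift b j)) => x _; rewrite !mxE.
Qed.

Lemma mxpartialC p q (F : 'rV[R]_n -> 'M[R]_(p, q)) a b x :
  mxsmooth D F -> D x ->
  mxpartial a (mxpartial b F) x = mxpartial b (mxpartial a F) x.
Proof.
move=> CF Dx; apply/matrixP => c d; rewrite [LHS]mxE [RHS]mxE.
transitivity (partial a (partial b (fun y => F y c d)) x).
  by congr (partial a _ x); apply/funext => y; rewrite mxE.
rewrite (@partialC _ _ (fun y => F y c d) D a b x oD (CF c d 2%N) Dx).
by congr (partial b _ x); apply/funext => y; rewrite mxE.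
Qed.

End MatrixSmooth.

Lemma mxsmooth_comp (R : realType) m n p q (D : set 'rV[R]_n) (E : set 'rV[R]_m)
    (F : 'rV[R]_m -> 'M[R]_(p, q)) (phi : 'rV[R]_n -> 'rV[R]_m) :
  open D -> (forall x, D x -> E (phi x)) ->
  mxsmooth E F -> mxsmooth D phi -> mxsmooth D (fun x => F (phi x)).
Proof.
move=> oD DE CF Cphi b c k.
apply: (Ck_comp (f := fun y => F y b c) oD DE (CF b c k)).
by move=> d; exact: Cphi.
Qed.

Lemma mxdiff_comp (R : realType) m n p q 
    (F : 'rV[R]_m -> 'M[R]_(p, q)) (phi : 'rV[R]_n -> 'rV[R]_m) x :
  mxdiff phi x -> mxdiff F (phi x) -> mxdiff (fun x => F (phi x)) x.
Proof.
move=> dphi dF b c.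
by apply: (@differentiable_comp_row _ _ _ (fun y => F y b c)).
Qed.

Lemma mxpartial_comp (R : realType) m n p q a
    (F : 'rV[R]_m -> 'M[R]_(p, q)) (phi : 'rV[R]_n -> 'rV[R]_m) x :
  mxdiff phi x -> mxdiff F (phi x) ->
  mxpartial a (fun x => F (phi x)) x =
  \sum_e mxpartial a phi x 0 e *: mxpartial e F (phi x).
Proof.
move=> dphi dF; apply/matrixP => b c; rewrite mxE summxE.
rewrite (@partial_comp _ _ _ _ (fun y => F y b c)) //.
by apply: eq_bigr => e _; rewrite !mxE mulrC.
Qed.

(** * Derivatives in charts *)

Section SmoothManifolds.
Context {R : realType} {n : nat} {M : topologicalType} (A : atlas R n M).
Hypothesis hA : smooth_manifold A.
Implicit Types (i j k : idx A) (p : M) (x : 'rV[R]_n) (a : 'I_n).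

Lemma chart_image_coord i U p : dom i p -> U p -> chart_image i U (Defs.coord i p).
Proof. by move=> ip Up; exists p. Qed.

Lemma param_dom i U x : chart_image i U x ->
  [/\ dom i (param i x), U (param i x) & Defs.coord i (param i x) = x].
Proof. by move=> [p [ip Up] <-]; rewrite (sm_coordK hA). Qed.

Lemma chart_imageW i U x : chart_image i U x -> chart_image i setT x.
Proof. by move=> [p [ip Up] <-]; exists p. Qed.

Lemma chart_image_open i U : open U -> open (chart_image i U).
Proof.
move=> oU; rewrite openE => x Ux.
have [ix Upx cx] := param_dom Ux; have Tx := chart_imageW Ux.
have cpar := sm_param_continuous hA Tx.
have : \near x, chart_image i setT x /\ U (param i x).
  apply: filterI.
    by apply: open_nbhs_nbhs; split=> //; exact: (sm_image_open hA).
  by apply: cpar; exact: open_nbhs_nbhs.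
apply: filterS => y [/param_dom[iy _ cy] Uy].
by rewrite -cy; exact: chart_image_coord.
Qed.

Lemma chart_domain_open i : open (chart_image i setT).
Proof. exact: (sm_image_open hA). Qed.

Lemma overlap_open i j : open (chart_image i (dom j)).
Proof. by apply: chart_image_open; exact: (sm_dom_open hA). Qed.

Lemma near_overlap i j p : dom i p -> dom j p ->
  \forall x \near Defs.coord i p, chart_image i (dom j) x.
Proof.
move=> ip jp; apply: open_nbhs_nbhs; split; first exact: overlap_open.
exact: chart_image_coord.
Qed.

Lemma near_chart i p : dom i p ->
  \forall x \near Defs.coord i p, chart_image i setT x.
Proof.
move=> ip; apply: open_nbhs_nbhs; split; first exact: chart_domain_open.
exact: chart_image_coord.
Qed.

Lemma transition_mxsmooth i j :
  mxsmooth (chart_image i (dom j)) (fun x => Defs.coord j (param i x)).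
Proof. by move=> b c; rewrite ord1; exact: (sm_transition hA). Qed.

(** Derivative of a matrix valued function on the manifold along a coordinate
    of the chart [i]. *)
Definition chart_mx q r i a (F : M -> 'M[R]_(q, r)) p : 'M[R]_(q, r) :=
  mxpartial a (fun x => F (param i x)) (Defs.coord i p).

Lemma chart_partial_mxE i a (F : M -> 'M[R]_n) p :
  chart_partial_mx i a F p = chart_mx i a F p.
Proof. by []. Qed.

(** Differentiability at a point, read in the chart [i]. *)
Definition chart_mxdiff q r i (F : M -> 'M[R]_(q, r)) p :=
  mxdiff (fun x => F (param i x)) (Defs.coord i p).

(** Smoothness, read in the chart [i], on the overlap with [U]. *)
Definition chart_mxsmooth q r i (U : set M) (F : M -> 'M[R]_(q, r)) :=
  mxsmooth (chart_image i U) (fun x => F (param i x)).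

Lemma chart_mxsmooth_diff q r i (U : set M) (F : M -> 'M[R]_(q, r)) p :
  chart_mxsmooth i U F -> dom i p -> U p -> chart_mxdiff i F p.
Proof. by move=> sF ip Up; apply: mxsmooth_mxdiff sF _; exact: chart_image_coord. Qed.

Lemma near_eq_chart_mx q r i a (U : set M) (F G : M -> 'M[R]_(q, r)) p : 
  open U -> dom i p -> U p ->
  (forall q, dom i q -> U q -> F q = G q) -> chart_mx i a F p = chart_mx i a G p.
Proof.
move=> oU ip Up FG; apply: near_eq_mxpartial.
have : open_nbhs (Defs.coord i p) (chart_image i U).
  by split; [exact: chart_image_open|exact: chart_image_coord].
by move=> /open_nbhs_nbhs; apply: filterS => x /param_dom[ix Ux _]; exact: FG.
Qed.

Lemma near_eq_chart_mxdiff q r i (U : set M) (F G : M -> 'M[R]_(q, r)) p : 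
  open U -> dom i p -> U p ->
  (forall q, dom i q -> U q -> F q = G q) -> chart_mxdiff i F p -> chart_mxdiff i G p.
Proof.
move=> oU ip Up FG; apply: near_eq_mxdiff.
have : open_nbhs (Defs.coord i p) (chart_image i U).
  by split; [exact: chart_image_open|exact: chart_image_coord].
by move=> /open_nbhs_nbhs; apply: filterS => x /param_dom[ix Ux _]; exact: FG.
Qed.

Lemma chart_mxsmooth_eq q r i (U : set M) (F G : M -> 'M[R]_(q, r)) : open U ->
  (forall p, dom i p -> U p -> F p = G p) ->
  chart_mxsmooth i U F -> chart_mxsmooth i U G.
Proof.
move=> oU FG; apply: mxsmooth_eq; first exact: chart_image_open.
by move=> x /param_dom[ix Ux _]; exact: FG.
Qed.

Lemma jacE i j p b a :
  jac i j p b a = chart_mx i a (Defs.coord j) p 0 b.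
Proof. by rewrite !mxE. Qed.

Lemma jac_mxsmooth i j : chart_mxsmooth i (dom j) (jac i j).
Proof.
move=> b a.
apply: (@smooth_on_eq _ _ _ (@overlap_open i j)
  (fun x => mxpartial a (fun x => Defs.coord j (param i x)) x 0 b)).
  by move=> x /param_dom[_ _ cx]; rewrite jacE /chart_mx cx.
by apply: mxsmooth_partial; [exact: overlap_open|exact: transition_mxsmooth].
Qed.

Lemma transition_near i j q r (F : M -> 'M[R]_(q, r)) p : dom i p -> dom j p ->
  \forall x \near Defs.coord i p,
    F (param j (Defs.coord j (param i x))) = F (param i x).
Proof.
move=> ip jp; apply: filterS (near_overlap ip jp) => x /param_dom[ix jx _].
by rewrite (sm_coordK hA).
Qed.

Lemma chart_mxdiff_change i j q r (F : M -> 'M[R]_(q, r)) p :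
  dom i p -> dom j p -> chart_mxdiff j F p -> chart_mxdiff i F p.
Proof.
move=> ip jp dF; apply: near_eq_mxdiff (transition_near F ip jp) _.
apply: (@mxdiff_comp _ _ _ _ _ (fun y => F (param j y))).
  by apply: mxsmooth_mxdiff (@transition_mxsmooth i j) _; exact: chart_image_coord.
by rewrite (sm_coordK hA).
Qed.

(** Change of chart for derivatives. *)
Lemma chart_mx_change i j q r (F : M -> 'M[R]_(q, r)) p a :
  dom i p -> dom j p -> chart_mxdiff j F p ->
  chart_mx i a F p = \sum_e jac i j p e a *: chart_mx j e F p.
Proof.
move=> ip jp dF; rewrite /chart_mx.
rewrite -(near_eq_mxpartial a (transition_near F ip jp)).
rewrite (@mxpartial_comp _ _ _ _ _ a (fun y => F (param j y))); last 2 first.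
- by apply: mxsmooth_mxdiff (@transition_mxsmooth i j) _; exact: chart_image_coord.
- by rewrite (sm_coordK hA).
by apply: eq_bigr => e _; rewrite (sm_coordK hA) // jacE.
Qed.

Lemma coord_mxdiff i j p : dom i p -> dom j p -> chart_mxdiff i (Defs.coord j) p.
Proof.
move=> ip jp; apply: mxsmooth_mxdiff (@transition_mxsmooth i j) _.
exact: chart_image_coord.
Qed.

(** The chain rule for transition maps. *)
Lemma jac_cocycle i j k p : dom i p -> dom j p -> dom k p ->
  jac i k p = jac j k p *m jac i j p.
Proof.
move=> ip jp kp; apply/matrixP => b a; rewrite jacE.
rewrite (chart_mx_change _ ip jp); last exact: coord_mxdiff.
rewrite summxE mxE; apply: eq_bigr => e _.
by rewrite mxE jacE mulrC [in RHS]jacE.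
Qed.

Lemma jac_id i p : dom i p -> jac i i p = 1%:M.
Proof.
move=> ip; apply/matrixP => b a; rewrite jacE /chart_mx mxE [RHS]mxE.
have : \forall x \near Defs.coord i p, Defs.coord i (param i x) 0 b = x 0 b.
  by apply: filterS (near_chart ip) => x /param_dom[_ _ ->].
move=> /(near_eq_partial a) ->.
transitivity (('D_(delta_mx 0 a) (@id 'rV[R]_n) (Defs.coord i p)) 0 b).
  by rewrite derive_mx ?mxE //; exact: derivable_id.
by rewrite derive_id mxE eqxx.
Qed.

Lemma jac_inv i j p : dom i p -> dom j p -> jac j i p *m jac i j p = 1%:M.
Proof. by move=> ip jp; rewrite -jac_cocycle // jac_id. Qed.

End SmoothManifolds.

(** * The cotangent bundle as a smooth manifold *)

Section EuclideanSecondCountable.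

(** Balls of radius 1/(k+1) around rational points form a countable basis. *)
Lemma row_second_countable (R : realType) n : @second_countable 'rV[R]_n.
Proof.
pose c (q : 'rV[rat]_n * nat) : set 'rV[R]_n :=
  ball (map_mx ratr q.1 : 'rV[R]_n) (q.2.+1%:R^-1 : R).
exists (c @` setT).
  exact: sub_countable (card_image_le _ _) (countableP _).
split; first by move=> _ [q _ <-]; apply: ball_open; rewrite invr_gt0.
move=> x U /nbhs_ballP[e /= e0 eU].
have [k ke] : exists k : nat, (k.+1%:R^-1 : R) < e / 2.
  have /ltr_add_invr[k] : 0 < e / 2 by rewrite divr_gt0.
  by rewrite add0r => ke; exists k.
have k0 : 0 < (k.+1%:R^-1 : R) by rewrite invr_gt0.
have /choice[q qP] (b : 'I_n) : exists r : rat, `|x 0 b - ratr r| < k.+1%:R^-1.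
  have := @dense_rat R (ball (x 0 b) k.+1%:R^-1) _ (@ball_open _ _ (x 0 b) _).
  case; first by exists (x 0 b); exact: ballxx.
  by move=> y [yb [r _ ry]]; exists r; rewrite ry.
exists (c (\row_b q b, k)).
  split; first by exists (\row_b q b, k).
  split=> // a b; rewrite ord1 !mxE /ball /= distrC.
  exact: qP.
apply: subset_trans eU => y yb.
pose r0 : 'rV[R]_n := map_mx ratr (\row_b q b).
rewrite [e]splitr; apply: (@ball_triangle R 'rV[R]_n r0).
  apply: le_ball (ltW ke) _ _; split=> // a b; rewrite ord1 !mxE /ball /=.
  exact: qP.
exact: le_ball (ltW ke) _ yb.
Qed.

End EuclideanSecondCountable.

Section CotangentCharts.
Context {R : realType} {n : nat} {M : topologicalType} (A : atlas R n M).
Hypothesis hA : smooth_manifold A.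
Implicit Types (i j k : idx A) (p : M) (q : cotangent A) (z : 'rV[R]_(n + n)).

Lemma comp_change i j q : dom i (base q) -> dom j (base q) ->
  comp q j = comp q i *m jac j i (base q).
Proof. by case: q => p c [c0 cJ] /= ip jp; exact: cJ. Qed.

Lemma cotangent_eq i q q' : base q = base q' -> dom i (base q) ->
  comp q i = comp q' i -> q = q'.
Proof.
case: q => p c [c0 cJ]; case: q' => p' c' [c0' cJ'] /= E; subst p' => ip ci.
suff E : c = c' by subst c'; congr Cotangent; exact: Prop_irrelevance.
apply/funext => k; have [kp|kp] := pselect (dom k p).
  by rewrite (cJ k i) // (cJ' k i) // ci.
by rewrite c0 // c0'.
Qed.

(** Every row vector is the family of components in the chart [i] of some
    covector; its other components are given by the Jacobian matrices. *)
Lemma covector_exists i p (y : 'rV[R]_n) : dom i p ->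
  exists q : cotangent A, base q = p /\ comp q i = y.
Proof.
move=> ip.
pose c k : 'rV[R]_n := if pselect (dom k p) then y *m jac k i p else 0.
have cP : (forall k, ~ dom k p -> c k = 0) /\
   (forall k l, dom k p -> dom l p -> c k = c l *m jac k l p).
  split=> [k kp|k l kp lp]; rewrite /c; first by case: pselect.
  case: (pselect (dom k p)) => [?|//]; case: (pselect (dom l p)) => [?|//].
  by rewrite -mulmxA -(jac_cocycle hA).
exists (@Cotangent _ _ _ A p c cP); split=> //=.
by rewrite /c; case: (pselect (dom i p)) => [?|//]; rewrite (jac_id hA) // mulmx1.
Qed.

Lemma ct_paramP i z : chart_image i setT (lsubmx z) ->
  ct_dom i (ct_param i z) /\ ct_coord i (ct_param i z) = z.
Proof.
move=> /(param_dom hA)[ip _ cz]; rewrite /ct_param.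
have [q [bq cq]] := covector_exists (rsubmx z) ip.
case: xgetP => [_ -> //|/(_ q)]; case; split; first by rewrite /ct_dom /= bq.
by rewrite /ct_coord bq cz cq hsubmxK.
Qed.

Lemma ct_coordK i q : ct_dom i q -> ct_param i (ct_coord i q) = q.
Proof.
move=> iq; have Tq : chart_image i setT (lsubmx (ct_coord i q)).
  by rewrite row_mxKl; exact: chart_image_coord.
have [ir /eq_row_mx[Eb Ec]] := ct_paramP Tq.
apply: (@cotangent_eq i) => //.
by rewrite -(sm_coordK hA ir) Eb (sm_coordK hA).
Qed.

Lemma base_ct_param i z : chart_image i setT (lsubmx z) ->
  base (ct_param i z) = param i (lsubmx z).
Proof.
by move=> /ct_paramP[iz E]; rewrite -[in RHS]E row_mxKl (sm_coordK hA).
Qed.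

Lemma comp_ct_param i z : chart_image i setT (lsubmx z) ->
  comp (ct_param i z) i = rsubmx z.
Proof. by move=> /ct_paramP[iz E]; rewrite -[in RHS]E row_mxKr. Qed.

Notation B := (cotangent_atlas A).

Lemma ct_chart_imageE i (U : set M) z :
  chart_image (i : idx B) (fun q => U (base q)) z <-> chart_image i U (lsubmx z).
Proof.
split=> [[q [iq Uq] <-]|Uz].
  by rewrite /= row_mxKl; exact: chart_image_coord.
have Tz := chart_imageW Uz.
have [iq E] := ct_paramP Tz.
exists (ct_param i z) => //; split => //.
by rewrite base_ct_param //; have [] := param_dom hA Uz.
Qed.

Lemma ct_transitionE i j z : chart_image i (dom j) (lsubmx z) ->
  ct_coord j (ct_param i z) =
  row_mx (Defs.coord j (param i (lsubmx z)))
         (rsubmx z *m jac j i (param i (lsubmx z))).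
Proof.
move=> Jz; have Tz := chart_imageW Jz; have [ip jp _] := param_dom hA Jz.
by rewrite /ct_coord base_ct_param // (@comp_change i) ?base_ct_param // comp_ct_param.
Qed.

(** [jac j i] is a function on the chart [j]; it is also smooth when read in the
    chart [i], as the inverse of [jac i j]. *)
Lemma jac_mxsmoothV i j : chart_mxsmooth i (dom j) (jac j i).
Proof.
apply: (@mxsmooth_eq _ _ _ (@overlap_open _ _ _ _ hA i j) _ _
   (fun x => invmx (jac i j (param i x)))).
  move=> x /(param_dom hA)[ix jx _].
  have JJ := jac_inv hA ix jx; have [_ u] := mulmx1_unit JJ.
  by rewrite -[RHS]mulmx1 -(mulmxV u) mulmxA JJ mul1mx.
apply: mxsmooth_inv; [exact: overlap_open|move=> x /(param_dom hA)[ix jx _]|].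
  by have [] := mulmx1_unit (jac_inv hA ix jx).
exact: jac_mxsmooth.
Qed.

(** The set of pairs (x, y) with [x] in [D]. *)
Definition lsub_preimage (D : set 'rV[R]_n) : set 'rV[R]_(n + n) :=
  [set z | D (lsubmx z)].

Lemma lsub_preimage_open (D : set 'rV[R]_n) : open D -> open (lsub_preimage D).
Proof.
by move=> oD; apply: open_comp => // z _; exact: continuous_lsubmx.
Qed.

Lemma lsubmx_mxsmooth (E : set 'rV[R]_(n + n)) : open E ->
  mxsmooth E (fun z : 'rV[R]_(n + n) => lsubmx z).
Proof.
move=> oE b c; rewrite ord1 => k.
by apply: (Ck_eq oE _ (Ck_coord oE k (lshift n c))) => z _; rewrite mxE.
Qed.

Lemma rsubmx_mxsmooth (E : set 'rV[R]_(n + n)) : open E ->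
  mxsmooth E (fun z : 'rV[R]_(n + n) => rsubmx z).
Proof.
move=> oE b c; rewrite ord1 => k.
by apply: (Ck_eq oE _ (Ck_coord oE k (rshift n c))) => z _; rewrite mxE.
Qed.

Lemma mxsmooth_lsub s r (D : set 'rV[R]_n) (F : 'rV[R]_n -> 'M[R]_(s, r)) :
  open D -> mxsmooth D F -> mxsmooth (lsub_preimage D) (fun z => F (lsubmx z)).
Proof.
move=> oD sF; have oE := lsub_preimage_open oD.
by apply: (mxsmooth_comp oE _ sF (lsubmx_mxsmooth oE)).
Qed.

Lemma ct_transition_mxsmooth i j :
  mxsmooth (lsub_preimage (chart_image i (dom j)))
    (fun z => ct_coord j (ct_param i z)).
Proof.
have oD := @overlap_open _ _ _ _ hA i j.
have oE := lsub_preimage_open oD.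
apply: (mxsmooth_eq oE (F := fun z =>
  row_mx (Defs.coord j (param i (lsubmx z)))
         (rsubmx z *m jac j i (param i (lsubmx z))))).
  by move=> z Dz; rewrite ct_transitionE.
apply: (mxsmooth_row oE).
  exact: (mxsmooth_lsub oD (@transition_mxsmooth _ _ _ _ hA i j)).
apply: (mxsmoothM oE); first exact: rsubmx_mxsmooth.
exact: (mxsmooth_lsub oD (@jac_mxsmoothV i j)).
Qed.

End CotangentCharts.

Section CotangentManifold.
Context {R : realType} {n : nat} {M : topologicalType} (A : atlas R n M).
Hypothesis hA : smooth_manifold A.
Implicit Types (i j k : idx A) (p : M) (q : cotangent A) (z : 'rV[R]_(n + n)).

Lemma ct_subbase_open (U : set (cotangent A)) : ct_subbase U -> open U.
Proof.
move=> sU; exists [set U]; last by rewrite bigcup_set1.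
by move=> _ ->; exact: finI_from1.
Qed.

Lemma ct_chart_open i (V : set 'rV[R]_(n + n)) : open V ->
  open (ct_dom (A := A) i `&` ct_coord i @^-1` V).
Proof. by move=> oV; apply: ct_subbase_open; exists i, V. Qed.

Lemma ct_dom_open i : open (ct_dom (A := A) i).
Proof. by have := ct_chart_open i openT; rewrite preimage_setT setIT. Qed.

(** Continuity can be tested on the sets that generate the topology. *)
Lemma continuous_into_cotangent (T : topologicalType) (f : T -> cotangent A)
    (x : T) :
  (forall i (V : set 'rV[R]_(n + n)),
     open V -> ct_dom i (f x) -> V (ct_coord i (f x)) ->
     \forall y \near x, ct_dom i (f y) /\ V (ct_coord i (f y))) ->
  {for x, continuous f}.
Proof.
move=> H U; rewrite nbhsE => -[_ [[E sE <-] [C EC Cfx]] sU].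
rewrite nbhs_filterE; apply: filterS sU _; apply: (@filterS _ _ _ C).
  by move=> y Cy; exists C.
have /sE [F sF FC] := EC; rewrite -FC; apply: filter_bigI => W FW.
have /sF := FW; rewrite inE => -[i [V [oV EW]]].
have : W (f x) by rewrite -FC in Cfx; exact: Cfx.
by rewrite EW => -[ifx Vfx]; exact: H.
Qed.

Lemma ct_coord_continuous i q : ct_dom i q ->
  {for q, continuous (ct_coord (A := A) i)}.
Proof.
move=> iq V; rewrite nbhsE => -[W [oW Wq] WV].
suff H : nbhs q (ct_coord i @^-1` W) by apply: filterS H => q'; exact: WV.
have : open_nbhs q (ct_dom i `&` ct_coord i @^-1` W) by split; [exact: ct_chart_open|].
by move=> /open_nbhs_nbhs; apply: filterS => q' [].
Qed.

Lemma base_continuous q : {for q, continuous (@base _ _ _ A)}.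
Proof.
have [i iq] := sm_cover hA (base q).
have cq := @ct_coord_continuous i q iq.
have E : \forall q' \near q, param i (lsubmx (ct_coord i q')) = base q'.
  have : open_nbhs q (ct_dom i) by split; [exact: ct_dom_open|].
  move=> /open_nbhs_nbhs; apply: filterS => q' iq'.
  by rewrite row_mxKl (sm_coordK hA).
rewrite /prop_for /continuous_at -(nbhs_singleton E).
apply: cvg_trans (near_eq_cvg E) _.
have cl : {for q, continuous (lsubmx \o ct_coord i)}.
  by apply: continuous_comp; [exact: cq|exact: continuous_lsubmx].
have cp : {for lsubmx (ct_coord i q), continuous (param i)}.
  rewrite row_mxKl; apply: (sm_param_continuous hA); exact: chart_image_coord.
exact: (continuous_comp cl cp).
Qed.

Lemma ct_param_continuous i z : chart_image i setT (lsubmx z) ->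
  {for z, continuous (ct_param (A := A) i)}.
Proof.
move=> Tz; apply: continuous_into_cotangent => j V oV jz Vz.
have Jz : chart_image i (dom j) (lsubmx z).
  have [iz Ez] := ct_paramP hA Tz; exists (base (ct_param i z)) => //.
  by rewrite -[in RHS]Ez row_mxKl.
have oE := lsub_preimage_open (@overlap_open _ _ _ _ hA i j).
have ctr : {for z, continuous (fun z => ct_coord j (ct_param i z))}.
  apply: mxdiff_continuous.
  exact: mxsmooth_mxdiff (@ct_transition_mxsmooth _ _ _ _ hA i j) Jz.
have NJ : nbhs z (lsub_preimage (chart_image i (dom j))) by apply: open_nbhs_nbhs.
have NV : nbhs z ((fun z => ct_coord j (ct_param i z)) @^-1` V).
  by apply: ctr; apply: open_nbhs_nbhs.
apply: filterS2 NJ NV => y Jy Vy; split=> //.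
rewrite /ct_dom /= (base_ct_param hA (chart_imageW Jy)).
by have [] := param_dom hA Jy.
Qed.

(** The charts are homeomorphisms: a neighbourhood of [q] contains the preimage
    of an open set by any given chart around [q]. *)
Lemma ct_nbhs_chart i q (U : set (cotangent A)) : ct_dom i q -> nbhs q U ->
  exists2 V : set 'rV[R]_(n + n), open V /\ V (ct_coord i q) &
    ct_dom i `&` ct_coord i @^-1` V `<=` U.
Proof.
move=> iq Uq.
have Tq : chart_image i setT (lsubmx (ct_coord i q)).
  by rewrite row_mxKl; exact: chart_image_coord.
have := ct_param_continuous Tq; rewrite /prop_for /continuous_at ct_coordK //.
move=> /(_ _ Uq); rewrite nbhs_filterE nbhsE => -[V oV VU].
exists V => // q' [iq' /VU] /=; by rewrite ct_coordK.
Qed.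

(** Covectors at distinct points are separated by the projection to the base,
    covectors at the same point by a common chart. *)
Lemma cotangent_hausdorff : hausdorff_space (cotangent A).
Proof.
rewrite open_hausdorff => q q' qq'.
have [E|bb'] := eqVneq (base q) (base q'); last first.
  have := sm_hausdorff hA; rewrite open_hausdorff.
  move=> /(_ _ _ bb')[[U V] /= [Uq Vq'] [oU oV UV]].
  exists (@base _ _ _ A @^-1` U, @base _ _ _ A @^-1` V) => /=.
    by rewrite !inE in Uq Vq' *.
  split; [by apply: open_comp => // x _; exact: base_continuous..|].
  by rewrite -preimage_setI (eqP UV) preimage_set0.
have [i iq] := sm_cover hA (base q).
have iq' : dom i (base q') by rewrite -E.
have cc' : ct_coord i q != ct_coord i q'.
  apply/eqP => /eq_row_mx[_ cc]; move/eqP: qq'; apply.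
  exact: (cotangent_eq (i := i)).
have : hausdorff_space 'rV[R]_(n + n) by exact: norm_hausdorff.
rewrite open_hausdorff => /(_ _ _ cc')[[U V] /= [Uq Vq'] [oU oV UV]].
exists (ct_dom i `&` ct_coord i @^-1` U, ct_dom i `&` ct_coord i @^-1` V) => /=.
  by rewrite !inE in Uq Vq' *.
split; [exact: ct_chart_open..|].
rewrite setIACA -preimage_setI (eqP UV) preimage_set0 setI0; exact/eqP.
Qed.

Lemma cotangent_second_countable : @second_countable (cotangent A).
Proof.
have [S cS [oS nS]] := sm_second_countable hA.
have [W cW [oW nW]] := @row_second_countable R (n + n).
(* [C (b, w)] is empty if [b] is not contained in the domain of a chart;
   otherwise a chart is chosen that depends on [b] only. *)
pose C (bw : set M * set 'rV[R]_(n + n)) : set (cotangent A) :=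
  [set q | exists h : (exists i, bw.1 `<=` dom i),
    bw.1 (base q) /\ bw.2 (ct_coord (projT1 (cid h)) q)].
exists (C @` (S `*` W)).
  by apply: sub_countable (card_image_le _ _) _; exact: countableX.
split.
  move=> _ [[b w] [/= Sb Ww] <-].
  have [h|nh] := pselect (exists i, b `<=` dom i); last first.
    rewrite (_ : C _ = set0); first exact: open0.
    by apply/seteqP; split=> // q [].
  rewrite (_ : C _ = @base _ _ _ A @^-1` b `&`
     (ct_dom (projT1 (cid h)) `&` ct_coord (projT1 (cid h)) @^-1` w)).
    apply: openI; last by apply: ct_chart_open; exact: oW.
    by apply: open_comp; [move=> x _; exact: base_continuous|exact: oS].
  apply/seteqP; split=> q /=.
    move=> [h' [bq wq]]; rewrite (Prop_irrelevance h h'); split => //; split => //.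
    by have := projT2 (cid h'); apply.
  by move=> [bq [_ wq]]; exists h.
move=> q U Uq.
have [j jq] := sm_cover hA (base q).
have [b [Sb bq] bj] : filter_from [set U | S U /\ U (base q)] id (dom j).
  by apply: nS; apply: open_nbhs_nbhs; split => //; exact: (sm_dom_open hA).
pose h : exists i, b `<=` dom i := ex_intro _ j bj.
set i := projT1 (cid h); have bi : b `<=` dom i := projT2 (cid h).
have iq : ct_dom i q by exact: bi.
have [V [oV Vq] VU] := ct_nbhs_chart iq Uq.
have [w [Ww wq] wV] : filter_from [set U | W U /\ U (ct_coord i q)] id V.
  by apply: nW; apply: open_nbhs_nbhs.
exists (C (b, w)).
  by split; [exists (b, w)|exists h].
move=> q' [h' [/= bq' wq']]; apply: VU; split; first exact: bi.
by apply: wV; rewrite /i (Prop_irrelevance h h').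
Qed.

Lemma ct_chart_imageTE i z : chart_image (i : idx (cotangent_atlas A)) setT z <->
  chart_image i setT (lsubmx z).
Proof. exact: (ct_chart_imageE hA i setT z). Qed.

Lemma ct_chart_imageT i : chart_image (i : idx (cotangent_atlas A)) setT =
  lsub_preimage (chart_image i setT).
Proof. by apply/seteqP; split => z /ct_chart_imageTE. Qed.

Lemma ct_overlapE i j : chart_image (i : idx (cotangent_atlas A))
    (@dom _ _ _ (cotangent_atlas A) j) = lsub_preimage (chart_image i (dom j)).
Proof.
by apply/seteqP; split => z /(ct_chart_imageE hA i (dom j) z).
Qed.

(** The cotangent bundle of a smooth manifold is a smooth manifold. *)
Lemma cotangent_smooth_manifold : smooth_manifold (cotangent_atlas A).
Proof.
split.
- exact: cotangent_hausdorff.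
- exact: cotangent_second_countable.
- by move=> q; have [i iq] := sm_cover hA (base q); exists i.
- exact: ct_dom_open.
- by move=> i; rewrite ct_chart_imageT; apply/lsub_preimage_open/chart_domain_open.
- exact: (ct_coordK hA).
- exact: ct_coord_continuous.
- by move=> i z /ct_chart_imageTE; exact: ct_param_continuous.
- move=> i j b; rewrite ct_overlapE.
  exact: (@ct_transition_mxsmooth _ _ _ _ hA i j 0 b).
Qed.

End CotangentManifold.

(** * Tensor fields and connections in moving frames *)

(* Distributes products of matrices over sums and associates them to the left. *)
Ltac mx_expand :=
  rewrite ?(mulmxDl, mulmxDr, mulmxBl, mulmxBr, mulNmx, mulmxN, mulmxA,
            opprD, opprK, opprB).

(* Proves an identity between sums of products of matrices in which the products
   are treated as indeterminates. *)
Ltac mx_abel :=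
  repeat (match goal with |- context [?X *m ?Y] =>
    let m := fresh "m" in set m := (X *m Y); clearbody m end);
  apply/matrixP => ? ?; rewrite !mxE; ring.

(** Derivative of a connection matrix in coordinates, P V Q - B Q with Q the
    inverse of P, in a direction in which the derivatives of P, B and V are A, C
    and X. *)
Lemma frame_derivative_identity (R : realType) n (P Q A B C V X : 'M[R]_n) :
  (A *m V + P *m X) *m Q + P *m V *m (- (Q *m A *m Q))
    - (C *m Q + B *m (- (Q *m A *m Q))) =
  A *m V *m Q + P *m X *m Q - P *m V *m Q *m A *m Q - C *m Q
    + B *m Q *m A *m Q.
Proof. by mx_expand; mx_abel. Qed.

(** The curvature of a connection given in the frame [P] by the matrices [U] and
    [V] (in the directions of the derivatives [A] and [B] of [P]) is conjugate
    by [P] to the expression of the curvature in the frame.  The second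
    derivative [C] of [P] cancels because it is the same in both orders. *)
Lemma frame_curvature_identity (R : realType) n (P Q A B C U V X Y : 'M[R]_n) :
  Q *m P = 1%:M ->
  (A *m V *m Q + P *m X *m Q - P *m V *m Q *m A *m Q - C *m Q
     + B *m Q *m A *m Q)
  - (B *m U *m Q + P *m Y *m Q - P *m U *m Q *m B *m Q - C *m Q
     + A *m Q *m B *m Q)
  + (P *m U *m Q - A *m Q) *m (P *m V *m Q - B *m Q)
  - (P *m V *m Q - B *m Q) *m (P *m U *m Q - A *m Q) =
  P *m (X - Y + U *m V - V *m U) *m Q.
Proof.
move=> QP; mx_expand.
by rewrite -!(mulmxA _ Q P) QP // !mulmx1; mx_abel.
Qed.

Section ChartMatrixCalculus.
Context {R : realType} {n : nat} {M : topologicalType} (A : atlas R n M).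
Hypothesis hA : smooth_manifold A.
Implicit Types (i j k : idx A) (p : M) (a b : 'I_n).

Lemma chart_mxM q r s i a (F : M -> 'M[R]_(q, r)) (G : M -> 'M[R]_(r, s)) p :
  chart_mxdiff i F p -> chart_mxdiff i G p -> dom i p ->
  chart_mx i a (fun p => F p *m G p) p =
  chart_mx i a F p *m G p + F p *m chart_mx i a G p.
Proof.
by move=> dF dG ip; rewrite {1}/chart_mx mxpartialM // (sm_coordK hA).
Qed.

Lemma chart_mx_inv q i a (F G : M -> 'M[R]_q) p :
  (forall p, dom i p -> F p *m G p = 1%:M) ->
  chart_mxdiff i F p -> chart_mxdiff i G p -> dom i p ->
  chart_mx i a G p = - (G p *m chart_mx i a F p *m G p).
Proof.
move=> FG dF dG ip.
have near1 : \forall x \near Defs.coord i p, F (param i x) *m G (param i x) = 1%:M.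
  by apply: filterS (near_chart hA ip) => x /(param_dom hA)[ix _ _]; exact: FG.
by rewrite {1}/chart_mx (mxpartial_inv a near1 dF dG) (sm_coordK hA).
Qed.

Lemma chart_mxsmooth_chart_mx q r i a (F : M -> 'M[R]_(q, r)) :
  chart_mxsmooth i setT F -> chart_mxsmooth i setT (chart_mx i a F).
Proof.
move=> sF; have oD := @chart_domain_open _ _ _ _ hA i.
apply: (mxsmooth_eq oD _ (mxsmooth_partial oD a sF)) => x /(param_dom hA)[_ _ cx].
by rewrite /chart_mx cx.
Qed.

Lemma chart_mxsmoothM q r s i (F : M -> 'M[R]_(q, r)) (G : M -> 'M[R]_(r, s)) :
  chart_mxsmooth i setT F -> chart_mxsmooth i setT G ->
  chart_mxsmooth i setT (fun p => F p *m G p).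
Proof. exact: (mxsmoothM (@chart_domain_open _ _ _ _ hA i)). Qed.

Lemma chart_mxsmoothB q r i (F G : M -> 'M[R]_(q, r)) :
  chart_mxsmooth i setT F -> chart_mxsmooth i setT G ->
  chart_mxsmooth i setT (fun p => F p - G p).
Proof. exact: (mxsmoothB (@chart_domain_open _ _ _ _ hA i)). Qed.

Lemma chart_mxsmooth_tr q r i (F : M -> 'M[R]_(q, r)) :
  chart_mxsmooth i setT F -> chart_mxsmooth i setT (fun p => (F p)^T).
Proof. exact: (mxsmooth_tr (@chart_domain_open _ _ _ _ hA i)). Qed.

(** Symmetry of second derivatives in a chart. *)
Lemma chart_mxC q r i a b (F : M -> 'M[R]_(q, r)) p :
  chart_mxsmooth i setT F -> dom i p ->
  chart_mx i a (chart_mx i b F) p = chart_mx i b (chart_mx i a F) p.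
Proof.
move=> sF ip.
have E c d : chart_mx i c (chart_mx i d F) p =
    mxpartial c (mxpartial d (fun x => F (param i x))) (Defs.coord i p).
  apply: near_eq_mxpartial; apply: filterS (near_chart hA ip) => x.
  by move=> /(param_dom hA)[_ _ cx]; rewrite /chart_mx cx.
rewrite !E (mxpartialC (@chart_domain_open _ _ _ _ hA i) a b sF) //.
exact: chart_image_coord.
Qed.

End ChartMatrixCalculus.

(** A frame field [P i] in each chart (with inverse [Q i]) and transition
    matrices [D i j] between these frames; tensor fields and connections are
    given by their components in the frames. *)
Section Frames.
Context {R : realType} {n : nat} {M : topologicalType} (A : atlas R n M).
Hypothesis hA : smooth_manifold A.
Implicit Types (i j k : idx A) (p : M) (a b : 'I_n).

Variables (P Q : idx A -> M -> 'M[R]_n) (D : idx A -> idx A -> M -> 'M[R]_n).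
Hypothesis sP : forall i, chart_mxsmooth i setT (P i).
Hypothesis sQ : forall i, chart_mxsmooth i setT (Q i).
Hypothesis PQ : forall i p, dom i p -> P i p *m Q i p = 1%:M.
Hypothesis jacP : forall i j p, dom i p -> dom j p ->
  jac i j p *m P i p = P j p *m D i j p.

Let QP i p : dom i p -> Q i p *m P i p = 1%:M.
Proof. by move=> ip; apply/mulmx1C/PQ. Qed.

Let dP i p : dom i p -> chart_mxdiff i (P i) p.
Proof. by move=> ip; exact: chart_mxsmooth_diff (sP i) ip I. Qed.

Let dQ i p : dom i p -> chart_mxdiff i (Q i) p.
Proof. by move=> ip; exact: chart_mxsmooth_diff (sQ i) ip I. Qed.

Lemma frame_jac i j p : dom i p -> dom j p ->
  jac i j p = P j p *m D i j p *m Q i p.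
Proof. by move=> ip jp; rewrite -jacP // -mulmxA PQ // mulmx1. Qed.

(** Components in coordinates of the endomorphism field with components [T] in
    the frames. *)
Definition frame_endo (T : tensor2 A) : tensor2 A :=
  fun i p => P i p *m T i p *m Q i p.

(** Components in coordinates of the bilinear field with components [T] in the
    frames. *)
Definition frame_form (T : tensor2 A) : tensor2 A :=
  fun i p => (Q i p)^T *m T i p *m Q i p.

(** Christoffel symbols of the connection with matrices [W] in the frames. *)
Definition frame_connection (W : christoffel A) : christoffel A :=
  fun i p a => P i p *m W i p a *m Q i p - chart_mx i a (P i) p *m Q i p.

Lemma frame_endomorphism_field (T : tensor2 A) :
  (forall i, chart_mxsmooth i setT (T i)) ->
  (forall i j p, dom i p -> dom j p -> D i j p *m T i p = T j p *m D i j p) ->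
  endomorphism_field (frame_endo T).
Proof.
move=> sT DT; split.
  by move=> i; exact: (chart_mxsmoothM hA (chart_mxsmoothM hA (sP i) (sT i)) (sQ i)).
move=> i j p ip jp; rewrite (frame_jac ip jp) /frame_endo.
rewrite !mulmxA -(mulmxA _ (Q j p)) QP // mulmx1.
rewrite -(mulmxA _ (Q i p)) QP // mulmx1.
by rewrite -(mulmxA _ (D i j p) (T i p)) DT // mulmxA.
Qed.

Lemma frame_bilinear_field (T : tensor2 A) :
  (forall i, chart_mxsmooth i setT (T i)) ->
  (forall i j p, dom i p -> dom j p ->
     T i p = (D i j p)^T *m T j p *m D i j p) ->
  bilinear_field (frame_form T).
Proof.
move=> sT DT; split.
  move=> i; have sQt := chart_mxsmooth_tr hA (sQ i).
  exact: (chart_mxsmoothM hA (chart_mxsmoothM hA sQt (sT i)) (sQ i)).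
move=> i j p ip jp; rewrite /frame_form (DT i j p ip jp).
have -> : (Q i p)^T *m ((D i j p)^T *m T j p *m D i j p) *m Q i p =
  (D i j p *m Q i p)^T *m T j p *m (D i j p *m Q i p).
  by rewrite trmx_mul !mulmxA.
have -> : D i j p *m Q i p = Q j p *m jac i j p.
  by rewrite frame_jac // !mulmxA QP // mul1mx.
by rewrite trmx_mul !mulmxA.
Qed.

Let dD i j p : dom i p -> dom j p -> chart_mxdiff i (D i j) p.
Proof.
move=> ip jp.
have oj : open (dom j) := sm_dom_open hA j.
apply: (near_eq_chart_mxdiff hA (F := fun p => Q j p *m (jac i j p *m P i p)) oj ip jp).
  by move=> q iq jq; rewrite jacP // mulmxA QP // mul1mx.
apply: mxdiffM; first exact: (chart_mxdiff_change hA ip jp (dQ jp)).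
apply: mxdiffM; last exact: dP.
exact: (chart_mxsmooth_diff (@jac_mxsmooth _ _ _ _ hA i j)).
Qed.

(** The hypothesis on [W] is the transformation law of the connection matrices
    under the change of frame [D]. *)
Lemma frame_affine_connection (W : christoffel A) :
  (forall i a, chart_mxsmooth i setT (fun p => W i p a)) ->
  (forall i j p, dom i p -> dom j p -> forall a,
     D i j p *m W i p a = chart_mx i a (D i j) p
       + \sum_e jac i j p e a *: (W j p e *m D i j p)) ->
  affine_connection (frame_connection W).
Proof.
move=> sW DW; split.
  move=> i a; have sdP := chart_mxsmooth_chart_mx hA a (sP i).
  exact: (chart_mxsmoothB hA (chart_mxsmoothM hA
    (chart_mxsmoothM hA (sP i) (sW i a)) (sQ i)) (chart_mxsmoothM hA sdP (sQ i))).
move=> i j p ip jp a; rewrite chart_partial_mxE.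
have dPj : chart_mxdiff i (P j) p := chart_mxdiff_change hA ip jp (dP jp).
have dDij := dD ip jp.
have oj : open (dom j) := sm_dom_open hA j.
rewrite (near_eq_chart_mx hA a (G := fun p => P j p *m D i j p *m Q i p) oj ip jp);
  last by move=> q iq jq; exact: frame_jac.
rewrite (chart_mxM hA) //; [|exact: mxdiffM|exact: dQ].
rewrite (chart_mxM hA) // (chart_mx_inv hA _ (@PQ i)) //; [|exact: dP|exact: dQ].
rewrite (chart_mx_change hA _ ip jp (dP jp)).
have -> : \sum_(e < n) jac i j p e a *: (frame_connection W j p e *m jac i j p)
   = P j p *m (\sum_e jac i j p e a *: (W j p e *m D i j p)) *m Q i p
     - (\sum_e jac i j p e a *: chart_mx j e (P j) p) *m D i j p *m Q i p.
  rewrite mulmx_sumr !mulmx_suml -sumrB; apply: eq_bigr => e _.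
  rewrite -!scalemxAl -!scalemxAr -!scalemxAl -scalerBr; congr (_ *: _).
  rewrite (frame_jac ip jp) /frame_connection mulmxBl !mulmxA.
  by rewrite -!(mulmxA _ (Q j p) (P j p)) QP // !mulmx1.
have -> : \sum_e jac i j p e a *: (W j p e *m D i j p) =
    D i j p *m W i p a - chart_mx i a (D i j) p by rewrite DW // addrC addKr.
rewrite (frame_jac ip jp) /frame_connection.
set S := \sum_e _; mx_expand.
rewrite -!(mulmxA _ (Q i p) (P i p)) QP // !mulmx1.
mx_abel.
Qed.

Lemma nabla_endo_frame (W : christoffel A) (T : tensor2 A) i p a : dom i p ->
  chart_mxdiff i (T i) p ->
  nabla_endo (frame_connection W) (frame_endo T) i p a =
  P i p *m (chart_mx i a (T i) p + W i p a *m T i p - T i p *m W i p a) *m Q i p.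
Proof.
move=> ip dT; rewrite /nabla_endo chart_partial_mxE.
rewrite (chart_mxM hA) //; [|by apply: mxdiffM; [exact: dP|]|exact: dQ].
rewrite (chart_mxM hA) //; last exact: dP.
rewrite (chart_mx_inv hA _ (@PQ i)) //; [|exact: dP|exact: dQ].
rewrite /frame_connection /frame_endo; mx_expand.
rewrite -!(mulmxA _ (Q i p) (P i p)) QP // !mulmx1.
mx_abel.
Qed.

Lemma nabla_form_frame (W : christoffel A) (T : tensor2 A) i p a : dom i p ->
  chart_mxdiff i (T i) p ->
  nabla_form (frame_connection W) (frame_form T) i p a =
  (Q i p)^T *m (chart_mx i a (T i) p - (W i p a)^T *m T i p - T i p *m W i p a)
    *m Q i p.
Proof.
move=> ip dT; rewrite /nabla_form chart_partial_mxE.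
have dQt : chart_mxdiff i (fun p => (Q i p)^T) p by exact/mxdiff_tr/dQ.
rewrite (chart_mxM hA) //; [|by apply: mxdiffM|exact: dQ].
rewrite (chart_mxM hA) //.
have -> : chart_mx i a (fun p => (Q i p)^T) p = (chart_mx i a (Q i) p)^T.
  exact: mxpartial_tr.
rewrite (chart_mx_inv hA _ (@PQ i)) //; [|exact: dP|exact: dQ].
rewrite /frame_connection /frame_form.
have PQt : (P i p)^T *m (Q i p)^T = 1%:M by rewrite -trmx_mul QP // trmx1.
have trN (X : 'M[R]_n) : (- X)^T = - X^T by exact: linearN.
have trB (X Y : 'M[R]_n) : (X - Y)^T = X^T - Y^T by exact: linearB.
rewrite trN trB !trmx_mul; mx_expand.
rewrite -!(mulmxA _ (Q i p) (P i p)) QP // !mulmx1.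
rewrite -!(mulmxA _ (P i p)^T (Q i p)^T) PQt !mulmx1.
mx_abel.
Qed.

Lemma curvature_frame (W : christoffel A) i p a b : dom i p ->
  (forall a, chart_mxdiff i (fun p => W i p a) p) ->
  curvature (frame_connection W) i p a b =
  P i p *m (chart_mx i a (fun p => W i p b) p - chart_mx i b (fun p => W i p a) p
            + W i p a *m W i p b - W i p b *m W i p a) *m Q i p.
Proof.
move=> ip dW; rewrite /curvature !chart_partial_mxE.
have dPa c : chart_mxdiff i (chart_mx i c (P i)) p.
  exact: (chart_mxsmooth_diff (chart_mxsmooth_chart_mx hA c (sP i)) ip I).
have E c d : chart_mx i c (fun q => frame_connection W i q d) p =
    chart_mx i c (fun q => P i q *m W i q d *m Q i q) p
    - chart_mx i c (fun q => chart_mx i d (P i) q *m Q i q) p.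
  apply: mxpartialB; last by apply: mxdiffM; [exact: dPa|exact: dQ].
  by apply: mxdiffM (dQ ip); apply: mxdiffM; [exact: dP|exact: dW].
have E' c d : chart_mx i c (fun q => frame_connection W i q d) p =
    chart_mx i c (P i) p *m W i p d *m Q i p
    + P i p *m chart_mx i c (fun q => W i q d) p *m Q i p
    - P i p *m W i p d *m Q i p *m chart_mx i c (P i) p *m Q i p
    - chart_mx i c (chart_mx i d (P i)) p *m Q i p
    + chart_mx i d (P i) p *m Q i p *m chart_mx i c (P i) p *m Q i p.
  rewrite E (chart_mxM hA) //; [|by apply: mxdiffM; [exact: dP|exact: dW]|exact: dQ].
  rewrite (chart_mxM hA) //; last exact: dP.
  rewrite (chart_mxM hA) //; last exact: dQ.
  rewrite (chart_mx_inv hA _ (@PQ i)) //; [|exact: dP|exact: dQ].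
  exact: frame_derivative_identity.
rewrite !E' (chart_mxC hA b a (sP i) ip) /frame_connection.
by apply: frame_curvature_identity; exact: QP.
Qed.

End Frames.

(** * Bilinear forms and uniqueness of the Levi-Civita connection *)

Section BilinearForms.
Context {R : realType} {n : nat}.
Implicit Types (J g h : 'M[R]_n).

Lemma form_delta h (a b : 'I_n) : form h (delta_mx a 0) (delta_mx b 0) = h a b.
Proof. by rewrite /form trmx_delta -rowE -colE !mxE. Qed.

Lemma form_tr h X Y : form h^T X Y = form h Y X.
Proof.
rewrite /form; transitivity ((X^T *m h^T *m Y)^T 0 0); first by rewrite [RHS]mxE.
by rewrite !trmx_mul !trmxK mulmxA.
Qed.

Lemma form_symP h : (forall X Y, form h X Y = form h Y X) <-> h^T = h.
Proof.
split=> [hs|hs X Y]; last by rewrite -{1}hs form_tr.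
by apply/matrixP => a b; rewrite mxE -!form_delta.
Qed.

Lemma form_mull h J X Y : form h (J *m X) Y = form (J^T *m h) X Y.
Proof. by rewrite /form trmx_mul !mulmxA. Qed.

Lemma form_mulr h J X Y : form h X (J *m Y) = form (h *m J) X Y.
Proof. by rewrite /form !mulmxA. Qed.

Lemma form_adjointP h J :
  (forall X Y, form h (J *m X) Y = form h X (J *m Y)) <-> J^T *m h = h *m J.
Proof.
split=> [hJ|hJ X Y]; last by rewrite form_mull form_mulr hJ.
by apply/matrixP => a b; rewrite -!form_delta -form_mull -form_mulr.
Qed.

Lemma form_nondegenerateP h :
  (forall X, (forall Y, form h X Y = 0) -> X = 0) <-> h \in unitmx.
Proof.
split=> [hn|hu X hX].
  rewrite -row_free_unit -kermx_eq0; apply/eqP/row_matrixP => a.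
  rewrite row0 -[row a _]trmxK; apply/eqP; rewrite trmx_eq0; apply/eqP.
  apply: hn => Y; rewrite /form trmxK -row_mul mulmx_ker row0 mul0mx.
  by rewrite mxE.
suff E : X^T *m h = 0.
  by apply/eqP; rewrite -trmx_eq0 -(mulmxK hu X^T) E mul0mx.
apply/rowP => b; have := hX (delta_mx b 0); rewrite /form -colE => H.
by rewrite [RHS]mxE -H [RHS]mxE.
Qed.

(** A tensor with three indices that is antisymmetric in one pair of indices and
    symmetric in another pair vanishes. *)
Lemma skew_symmetric_eq0 (E : 'I_n -> 'M[R]_n) :
  (forall a, (E a)^T = - E a) -> (forall a b c, E a c b = E b c a) ->
  forall a, E a = 0.
Proof.
move=> skew sym a; apply/matrixP => c b; rewrite [RHS]mxE.
have sk x y z : E x y z = - E x z y.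
  by have := congr1 (fun X : 'M[R]_n => X z y) (skew x); rewrite !mxE.
have E1 : E a c b = - E a b c by exact: sk.
have E2 : E a b c = E c b a by exact: sym.
have E3 : E c b a = - E c a b by exact: sk.
have E4 : E c a b = E b a c by exact: sym.
have E5 : E b a c = - E b c a by exact: sk.
have E6 : E b c a = E a c b by exact: sym.
lra.
Qed.

End BilinearForms.

Section LeviCivitaUniqueness.
Context {R : realType} {n : nat} {M : topologicalType} (A : atlas R n M).

(** The difference of two Levi-Civita connections, lowered by the metric, is
    antisymmetric in two arguments and symmetric in two, hence zero. *)
Lemma levi_civita_unique (g : tensor2 A) (G G' : christoffel A) :
  pseudo_riemannian g -> levi_civita g G -> levi_civita g G' ->
  forall i p, dom i p -> forall a, G i p a = G' i p a.
Proof.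
move=> [_ gs gn] [_ Gt Gg] [_ Gt' Gg'] i p ip a.
have gT : (g i p)^T = g i p by apply/form_symP; exact: gs.
have gU : g i p \in unitmx by apply/form_nondegenerateP; exact: gn.
suff E : g i p *m (G i p a - G' i p a) = 0.
  by apply/eqP; rewrite -subr_eq0 -(mulKmx gU (_ - _)) E mulmx0.
move: a; apply: skew_symmetric_eq0 => [a|a b c].
  rewrite trmx_mul gT linearB /= mulmxBl mulmxBr opprB.
  have := Gg i p ip a; have := Gg' i p ip a; rewrite /nabla_form.
  move/eqP; rewrite -addrA -opprD subr_eq0 => /eqP ->.
  move/eqP; rewrite -addrA -opprD subr_eq0 => /eqP E.
  apply/eqP; rewrite subr_eq addrAC -subr_eq opprK; apply/eqP.
  by rewrite -E addrC.
rewrite !mxE; apply: eq_bigr => k _; congr (_ * _).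
by rewrite !mxE (Gt _ _ ip) (Gt' _ _ ip).
Qed.

End LeviCivitaUniqueness.

(** * The generalized Norden structure at a point *)

Section NordenLiftMatrices.
Context {R : realType} {n : nat}.
Implicit Types (J g h N B : 'M[R]_n).

(** Matrix of [Jhat] in the basis (d/dx^i, dx^j). *)
Definition Jhat_mx J g : 'M[R]_(n + n) := block_mx J 0 g^T (- J^T).

(** Matrix of [ghat] in the basis (d/dx^i, dx^j), without symmetry assumption on
    [g]; for a symmetric [g] it simplifies as in [ghat_mxE]. *)
Definition ghat_mx J g : 'M[R]_(n + n) :=
  let s := invmx g^T in
  block_mx g (2^-1 *: (J^T *m g *m s)) (2^-1 *: (s^T *m g *m J)) (s^T *m g *m s).

Lemma JhatE J g u : Jhat J g u = Jhat_mx J g *m u.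
Proof.
rewrite -[u in RHS]vsubmxK mul_block_col mul0mx addr0 mulNmx.
by rewrite /Jhat /musical_flat /Jstar.
Qed.

Lemma ghatE J g u v : ghat J g u v = form (ghat_mx J g) u v.
Proof.
rewrite /form -[u in RHS]vsubmxK -[v in RHS]vsubmxK tr_col_mx.
rewrite mul_row_block mul_row_col /ghat /musical_sharp /form.
rewrite !mulmxDl -!scalemxAr -!scalemxAl !trmx_mul !mulmxA.
have addE (X Y : 'M[R]_1) : (X + Y) 0 0 = X 0 0 + Y 0 0 by rewrite mxE.
have sclE c (X : 'M[R]_1) : (c *: X) 0 0 = c * X 0 0 by rewrite mxE.
by rewrite !addE !sclE; ring.
Qed.

Lemma mx_of_map_mul m (T : 'M[R]_m) : mx_of_map (fun u => T *m u) = T.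
Proof. by apply/matrixP => a b; rewrite mxE -colE mxE. Qed.

Lemma mx_of_form_form m (T : 'M[R]_m) : mx_of_form (form T) = T.
Proof. by apply/matrixP => a b; rewrite mxE form_delta. Qed.

Lemma ghat_mxE J g : g^T = g -> g \in unitmx ->
  ghat_mx J g = block_mx g (2^-1 *: J^T) (2^-1 *: J) (invmx g).
Proof.
move=> gT gU; rewrite /ghat_mx gT trmx_inv gT mulVmx // mul1mx.
by rewrite mulmxK // mul1mx.
Qed.

Section Algebra.
Variables (J g : 'M[R]_n).
Hypotheses (gT : g^T = g) (gU : g \in unitmx) (JJ : J *m J = - 1%:M)
  (Jg : J^T *m g = g *m J).

Let JTJT : J^T *m J^T = - 1%:M.
Proof. by rewrite -trmx_mul JJ linearN /= trmx1. Qed.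

Let Jginv : J *m invmx g = invmx g *m J^T.
Proof.
by rewrite -[LHS](mulKmx gU) (mulmxA g) -Jg -mulmxA mulmxV // mulmx1.
Qed.

Lemma Jhat_mx_sq : Jhat_mx J g *m Jhat_mx J g = - 1%:M.
Proof.
rewrite /Jhat_mx mulmx_block gT !mul0mx !mulmx0 !addr0 add0r mulNmx Jg subrr JJ.
by rewrite mulmxN mulNmx opprK JTJT [in RHS]scalar_mx_block opp_block_mx !oppr0.
Qed.

Lemma ghat_mx_tr : (ghat_mx J g)^T = ghat_mx J g.
Proof.
rewrite ghat_mxE // tr_block_mx gT trmx_inv gT; congr block_mx.
  by rewrite linearZ.
by rewrite linearZ /= trmxK.
Qed.

Lemma ghat_mx_unit : ghat_mx J g \in unitmx.
Proof.
rewrite ghat_mxE //.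
(* The inverse: with xi = g Z, eliminating Z from X + JZ/2 and JX/2 + Z leaves
   X - J^2 X / 4 = 5/4 X. *)
pose H : 'M[R]_(n + n) :=
  (4 / 5) *: block_mx (invmx g) (- 2^-1 *: J) (- 2^-1 *: J^T) g.
suff /mulmx1_unit[] : block_mx g (2^-1 *: J^T) (2^-1 *: J) (invmx g) *m H = 1%:M by [].
rewrite /H -scalemxAr mulmx_block.
rewrite -!scalemxAl -!scalemxAr !scalerA mulmxV // mulVmx // JJ JTJT Jg Jginv.
have -> : 1%:M + (2^-1 * - 2^-1) *: - 1%:M = (5 / 4) *: (1%:M : 'M[R]_n).
  by apply/matrixP => a b; rewrite !mxE; lra.
have -> : (2^-1 * - 2^-1) *: - 1%:M + 1%:M = (5 / 4) *: (1%:M : 'M[R]_n).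
  by apply/matrixP => a b; rewrite !mxE; lra.
rewrite !scaleNr addNr subrr scale_block_mx !scaler0 scalerA.
have -> : 4 / 5 * (5 / 4) = 1 :> R by field.
by rewrite scale1r -scalar_mx_block.
Qed.

Lemma Jhat_ghat_adjoint :
  (Jhat_mx J g)^T *m ghat_mx J g = ghat_mx J g *m Jhat_mx J g.
Proof.
rewrite ghat_mxE // /Jhat_mx tr_block_mx !mulmx_block trmxK trmx0 gT.
rewrite [(- J^T)^T]linearN /= trmxK.
rewrite !mul0mx !mulmx0 !add0r !mulNmx !mulmxN.
rewrite -!scalemxAl -!scalemxAr Jg JJ JTJT Jginv mulmxV // mulVmx //.
congr block_mx; apply/matrixP => a b; rewrite !mxE; lra.
Qed.

End Algebra.

(* [B] is the Jacobian matrix of a change of chart and [N] its inverse. *)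
Section ChangeOfChart.
Variables (J g J' g' B N : 'M[R]_n).
Hypotheses (NB : N *m B = 1%:M) (JB : J' *m B = B *m J) (gB : g = B^T *m g' *m B)
  (gT : g^T = g) (gU : g \in unitmx) (gT' : g'^T = g') (gU' : g' \in unitmx).

Let BN : B *m N = 1%:M. Proof. exact: mulmx1C. Qed.

Let JN : J *m N = N *m J'.
Proof.
by rewrite -[LHS]mul1mx -NB -!mulmxA (mulmxA B) -JB -mulmxA BN mulmx1.
Qed.

Let JE : J = N *m J' *m B.
Proof. by rewrite -JN -mulmxA NB mulmx1. Qed.

Let ginvE : invmx g = N *m invmx g' *m N^T.
Proof.
have E : g *m (N *m invmx g' *m N^T) = 1%:M.
  rewrite gB !mulmxA -(mulmxA _ B N) BN mulmx1 -(mulmxA _ g') mulmxV // mulmx1.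
  by rewrite -trmx_mul NB trmx1.
by rewrite -[LHS]mulmx1 -E mulKmx.
Qed.

(** Action of the Jacobian matrix [B], with inverse [N], on pairs of a vector and
    a covector. *)
Definition jac_block : 'M[R]_(n + n) := block_mx B 0 0 N^T.

Lemma Jhat_mx_change : jac_block *m Jhat_mx J g = Jhat_mx J' g' *m jac_block.
Proof.
rewrite /jac_block /Jhat_mx !mulmx_block !mul0mx !mulmx0 !addr0 !add0r JB.
congr block_mx.
  by rewrite gT gT' gB !mulmxA -trmx_mul BN trmx1 mul1mx.
by rewrite mulmxN mulNmx -!trmx_mul JN.
Qed.

Lemma ghat_mx_change : ghat_mx J g = jac_block^T *m ghat_mx J' g' *m jac_block.
Proof.
rewrite !ghat_mxE // /jac_block tr_block_mx !trmx0 trmxK.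
rewrite !mulmx_block !mul0mx !mulmx0 !addr0 !add0r.
rewrite -!scalemxAr -!scalemxAl -gB -ginvE; congr block_mx; congr (_ *: _) => //.
by rewrite {1}JE !trmx_mul mulmxA.
Qed.

End ChangeOfChart.

End NordenLiftMatrices.

(** * Derivatives on the cotangent bundle *)

Section CotangentCalculus.
Context {R : realType} {n : nat} {M : topologicalType} (A : atlas R n M).
Hypothesis hA : smooth_manifold A.
Notation B := (cotangent_atlas A).
Implicit Types (i j : idx A) (q : cotangent A) (a e : 'I_n).

Lemma lsubmx_delta (s : nat) (a : 'I_n) :
  lsubmx (delta_mx 0 (lshift s a) : 'rV[R]_(n + s)) = delta_mx 0 a.
Proof. by apply/rowP => b; rewrite !mxE (inj_eq (@lshift_inj _ _)). Qed.

Lemma lsubmx_delta0 (s : nat) (k : 'I_s) :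
  lsubmx (delta_mx 0 (rshift n k) : 'rV[R]_(n + s)) = 0.
Proof. by apply/rowP => b; rewrite !mxE eq_lrshift. Qed.

Lemma partial_lsub (f : 'rV[R]_n -> R) (z : 'rV[R]_(n + n)) a :
  partial (lshift n a) (fun z => f (lsubmx z)) z = partial a f (lsubmx z).
Proof.
rewrite /partial /derive; congr (lim (_ @ 0^')); apply/funext => h /=.
by congr (_ *: (f _ - _)); rewrite linearD linearZ /= lsubmx_delta.
Qed.

Lemma partial_lsub0 (f : 'rV[R]_n -> R) (z : 'rV[R]_(n + n)) a :
  partial (rshift n a) (fun z => f (lsubmx z)) z = 0.
Proof.
rewrite -[RHS](partial_cst (rshift n a) (0 : R) z) /partial /derive.
congr (lim (_ @ 0^')); apply/funext => h /=.
have -> : lsubmx (h *: delta_mx 0 (rshift n a) + z) = lsubmx z.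
  by rewrite linearD linearZ /= lsubmx_delta0 scaler0 add0r.
by rewrite !subrr.
Qed.

Lemma mxpartial_rsub (z : 'rV[R]_(n + n)) (c : 'I_(n + n)) :
  mxpartial c (fun z : 'rV[R]_(n + n) => rsubmx z) z = rsubmx (delta_mx 0 c).
Proof.
apply/matrixP => b d; rewrite ord1 mxE [RHS]mxE.
transitivity (partial c (fun z => z 0 (rshift n d)) z).
  by congr (partial c _ z); apply/funext => y; rewrite mxE.
transitivity (('D_(delta_mx 0 c) (@id 'rV[R]_(n + n)) z) 0 (rshift n d)).
  by rewrite derive_mx ?mxE //; exact: derivable_id.
by rewrite derive_id.
Qed.

Lemma near_ct_chart i q : ct_dom i q ->
  \forall z \near ct_coord i q, chart_image i setT (lsubmx z).
Proof.
move=> iq; have := near_chart (cotangent_smooth_manifold hA) (i := i) (p := q) iq.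
by apply: filterS => z /(ct_chart_imageTE hA).
Qed.

Lemma chart_mxsmooth_base r s i (F : M -> 'M[R]_(r, s)) :
  chart_mxsmooth i setT F ->
  chart_mxsmooth (i : idx B) setT (fun q => F (base q)).
Proof.
move=> sF; rewrite /chart_mxsmooth (ct_chart_imageT hA).
have oD := @chart_domain_open _ _ _ _ hA i.
apply: (mxsmooth_eq (lsub_preimage_open oD) _ (mxsmooth_lsub oD sF)) => z Tz.
by rewrite (base_ct_param hA).
Qed.

Lemma chart_mx_base r s i a (F : M -> 'M[R]_(r, s)) q : ct_dom i q ->
  chart_mx (i : idx B) (lshift n a) (fun q => F (base q)) q =
  chart_mx i a F (base q).
Proof.
move=> iq; rewrite /chart_mx.
rewrite (near_eq_mxpartial _ (G := fun z => F (param i (lsubmx z)))); last first.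
  by apply: filterS (near_ct_chart iq) => z /(base_ct_param hA) <-.
apply/matrixP => b c; rewrite !mxE.
by rewrite (partial_lsub (fun y => F (param i y) b c)) row_mxKl.
Qed.

Lemma chart_mx_base0 r s i a (F : M -> 'M[R]_(r, s)) q : ct_dom i q ->
  chart_mx (i : idx B) (rshift n a) (fun q => F (base q)) q = 0.
Proof.
move=> iq; rewrite /chart_mx.
rewrite (near_eq_mxpartial _ (G := fun z => F (param i (lsubmx z)))); last first.
  by apply: filterS (near_ct_chart iq) => z /(base_ct_param hA) <-.
apply/matrixP => b c; rewrite mxE [RHS]mxE.
by rewrite (partial_lsub0 (fun y => F (param i y) b c)).
Qed.

Lemma comp_mxsmooth i : chart_mxsmooth (i : idx B) setT (fun q => comp q i).
Proof.
rewrite /chart_mxsmooth (ct_chart_imageT hA).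
have oE := lsub_preimage_open (@chart_domain_open _ _ _ _ hA i).
by apply: (mxsmooth_eq oE _ (rsubmx_mxsmooth oE)) => z Tz; rewrite (comp_ct_param hA).
Qed.

Lemma chart_mx_comp i (c : 'I_(n + n)) q : ct_dom i q ->
  chart_mx (i : idx B) c (fun q => comp q i) q = rsubmx (delta_mx 0 c).
Proof.
move=> iq; rewrite /chart_mx.
rewrite (near_eq_mxpartial _ (G := fun z => rsubmx z)); last first.
  by apply: filterS (near_ct_chart iq) => z /(comp_ct_param hA) <-.
exact: mxpartial_rsub.
Qed.

Lemma rsubmx_delta (a : 'I_n) :
  rsubmx (delta_mx 0 (rshift n a) : 'rV[R]_(n + n)) = delta_mx 0 a.
Proof. by apply/rowP => b; rewrite !mxE (inj_eq (@rshift_inj _ _)). Qed.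

Lemma rsubmx_delta0 (a : 'I_n) :
  rsubmx (delta_mx 0 (lshift n a) : 'rV[R]_(n + n)) = 0.
Proof. by apply/rowP => b; rewrite !mxE eq_rlshift. Qed.

Lemma chart_mxdiff_base r s i (F : M -> 'M[R]_(r, s)) q : ct_dom i q ->
  chart_mxdiff i F (base q) -> chart_mxdiff (i : idx B) (fun q => F (base q)) q.
Proof.
move=> iq dF; rewrite /chart_mxdiff.
apply: (near_eq_mxdiff (F := fun z => F (param i (lsubmx z)))).
  by apply: filterS (near_ct_chart iq) => z /(base_ct_param hA) <-.
apply: (@mxdiff_comp _ _ _ _ _ (fun x => F (param i x)) (fun z => lsubmx z)).
  by apply: (mxsmooth_mxdiff (lsubmx_mxsmooth openT)).
by rewrite row_mxKl.
Qed.

Lemma comp_mxdiff i q : ct_dom i q ->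
  chart_mxdiff (i : idx B) (fun q => comp q i) q.
Proof. by move=> iq; exact: (chart_mxsmooth_diff (@comp_mxsmooth i) iq I). Qed.

(** Derivatives of the contraction of the tautological covector [y] with a
    matrix valued function on the base. *)
Lemma chart_mx_contract r i a (F : M -> 'M[R]_(n, r)) q : ct_dom i q ->
  chart_mxdiff i F (base q) ->
  chart_mx (i : idx B) (lshift n a) (fun q => comp q i *m F (base q)) q =
  comp q i *m chart_mx i a F (base q).
Proof.
move=> iq dF; have hB := cotangent_smooth_manifold hA.
rewrite (chart_mxM hB) //; [|exact: comp_mxdiff|exact: chart_mxdiff_base].
by rewrite chart_mx_comp // rsubmx_delta0 mul0mx add0r chart_mx_base.
Qed.

Lemma chart_mx_contract_fiber r i a (F : M -> 'M[R]_(n, r)) q : ct_dom i q ->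
  chart_mxdiff i F (base q) ->
  chart_mx (i : idx B) (rshift n a) (fun q => comp q i *m F (base q)) q =
  delta_mx 0 a *m F (base q).
Proof.
move=> iq dF; have hB := cotangent_smooth_manifold hA.
rewrite (chart_mxM hB) //; [|exact: comp_mxdiff|exact: chart_mxdiff_base].
by rewrite chart_mx_comp // rsubmx_delta chart_mx_base0 // mulmx0 addr0.
Qed.

End CotangentCalculus.

Section CotangentJacobian.
Context {R : realType} {n : nat} {M : topologicalType} (A : atlas R n M).
Hypothesis hA : smooth_manifold A.
Notation B := (cotangent_atlas A).
Implicit Types (i j : idx A) (q : cotangent A) (a e : 'I_n).

Let hB : smooth_manifold B := cotangent_smooth_manifold hA.

Lemma jac_mxdiffV i j p : dom i p -> dom j p -> chart_mxdiff i (jac j i) p.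
Proof. exact: (chart_mxsmooth_diff (@jac_mxsmoothV _ _ _ _ hA i j)). Qed.

(** Derivatives of the fibre coordinates of the chart [j] along the base
    coordinates of the chart [i]. *)
Definition jac_slope i j q : 'M[R]_n :=
  \matrix_(b, a) (comp q i *m chart_mx i a (jac j i) (base q)) 0 b.

(** Jacobian matrix of a change of chart of the cotangent bundle. *)
Lemma jac_cotangent i j q : ct_dom i q -> ct_dom j q ->
  jac (i : idx B) j q =
  block_mx (jac i j (base q)) 0 (jac_slope i j q) (jac j i (base q))^T.
Proof.
move=> iq jq.
pose F q := row_mx (Defs.coord j (base q)) (comp q i *m jac j i (base q)).
have E b c : jac (i : idx B) j q b c = chart_mx (i : idx B) c F q 0 b.
  rewrite jacE (near_eq_chart_mx hB c (G := F) (@ct_dom_open _ _ _ A j) iq jq) //.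
  by move=> q' iq' jq'; rewrite /= /ct_coord (@comp_change _ _ _ _ i).
have El b c : chart_mx (i : idx B) c F q 0 (lshift n b) =
    chart_mx (i : idx B) c (fun q => Defs.coord j (base q)) q 0 b.
  rewrite [LHS]mxE [RHS]mxE; congr (partial c _ _); apply/funext => z.
  by rewrite row_mxEl.
have Er b c : chart_mx (i : idx B) c F q 0 (rshift n b) =
    chart_mx (i : idx B) c (fun q => comp q i *m jac j i (base q)) q 0 b.
  rewrite [LHS]mxE [RHS]mxE; congr (partial c _ _); apply/funext => z.
  by rewrite row_mxEr.
have dJ := jac_mxdiffV iq jq.
apply/matrixP => b c; rewrite E -[b]splitK -[c]splitK.
case: (fintype.split b) => b'; case: (fintype.split c) => c' /=.
- by rewrite block_mxEul El (chart_mx_base hA) // jacE.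
- by rewrite block_mxEur El (chart_mx_base0 hA) // !mxE.
- by rewrite block_mxEdl Er (chart_mx_contract hA) // [RHS]mxE.
- by rewrite block_mxEdr Er (chart_mx_contract_fiber hA) // -rowE !mxE.
Qed.

End CotangentJacobian.

(** * The frame of horizontal and vertical lifts *)

Section CotangentFrames.
Context {R : realType} {n : nat} {M : topologicalType} (A : atlas R n M).
Hypothesis hA : smooth_manifold A.
Notation B := (cotangent_atlas A).
Variable (G : christoffel A).
Hypothesis hG : affine_connection G.
Implicit Types (i j : idx A) (p : M) (q : cotangent A) (a b e k : 'I_n).

Let hB : smooth_manifold B := cotangent_smooth_manifold hA.

Lemma christoffel_mxsmooth i a : chart_mxsmooth i setT (fun p => G i p a).
Proof. by have [sG _] := hG; exact: sG. Qed.

Let dG i a p : dom i p -> chart_mxdiff i (fun p => G i p a) p.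
Proof. by move=> ip; exact: (chart_mxsmooth_diff (@christoffel_mxsmooth i a) ip I). Qed.

(** Lower left block of the matrix [Phi] of the horizontal and vertical lifts:
    the entry (l, b) is y_k Gamma^k_{bl}. *)
Definition slope i q : 'M[R]_n :=
  \matrix_(l, b) (comp q i *m G i (base q) b) 0 l.

(** Matrix of the frame of horizontal and vertical lifts. *)
Definition lift_frame i q : 'M[R]_(n + n) := block_mx 1%:M 0 (slope i q) 1%:M.

(** Inverse matrix of the frame. *)
Definition lift_coframe i q : 'M[R]_(n + n) := block_mx 1%:M 0 (- slope i q) 1%:M.

Lemma PhiE i q : Phi (G i (base q)) (comp q i) = lift_frame i q.
Proof.
rewrite /Phi /lift_frame; congr block_mx.
by apply/matrixP => l b; rewrite !mxE.
Qed.

Lemma lift_frameK i q : lift_frame i q *m lift_coframe i q = 1%:M.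
Proof.
rewrite /lift_frame /lift_coframe mulmx_block !mul1mx !mulmx1 !mul0mx !mulmx0.
by rewrite !addr0 add0r subrr -scalar_mx_block.
Qed.

Lemma invmx_lift_frame i q : invmx (lift_frame i q) = lift_coframe i q.
Proof.
have [u _] := mulmx1_unit (lift_frameK i q).
by rewrite -[LHS]mulmx1 -(lift_frameK i q) mulKmx.
Qed.

Lemma slope_mxsmooth i : chart_mxsmooth (i : idx B) setT (slope i).
Proof.
move=> l b; apply: (@smooth_on_eq _ _ _ (@chart_domain_open _ _ _ _ hB i)
  (fun z => (comp (ct_param i z) i *m G i (base (ct_param i z)) b) 0 l)).
  by move=> z _; rewrite [RHS]mxE.
exact: (chart_mxsmoothM hB (@comp_mxsmooth _ _ _ _ hA i)
  (chart_mxsmooth_base hA (@christoffel_mxsmooth i b))).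
Qed.

Lemma chart_mx_slopeE i (c : 'I_(n + n)) q l b :
  chart_mx (i : idx B) c (slope i) q l b =
  chart_mx (i : idx B) c (fun q => comp q i *m G i (base q) b) q 0 l.
Proof.
rewrite [LHS]mxE [RHS]mxE; congr (partial c _ _); apply/funext => z.
by rewrite mxE.
Qed.

Lemma chart_mx_slope i q a : ct_dom i q ->
  chart_mx (i : idx B) (lshift n a) (slope i) q =
  \matrix_(l, b) (comp q i *m chart_mx i a (fun p => G i p b) (base q)) 0 l.
Proof.
move=> iq; apply/matrixP => l b; rewrite chart_mx_slopeE [RHS]mxE.
by rewrite (chart_mx_contract hA a (F := fun p => G i p b)) //; exact: dG.
Qed.

Lemma chart_mx_slope_fiber i q k : ct_dom i q ->
  chart_mx (i : idx B) (rshift n k) (slope i) q =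
  \matrix_(l, b) G i (base q) b k l.
Proof.
move=> iq; apply/matrixP => l b; rewrite chart_mx_slopeE [RHS]mxE.
rewrite (chart_mx_contract_fiber hA k (F := fun p => G i p b)) //; last exact: dG.
by rewrite -rowE mxE.
Qed.

Lemma lift_frame_mxsmooth i : chart_mxsmooth (i : idx B) setT (lift_frame i).
Proof.
have oD := @chart_domain_open _ _ _ _ hB i.
exact: (mxsmooth_block oD (mxsmooth_cst oD _) (mxsmooth_cst oD _)
  (@slope_mxsmooth i) (mxsmooth_cst oD _)).
Qed.

Lemma lift_coframe_mxsmooth i : chart_mxsmooth (i : idx B) setT (lift_coframe i).
Proof.
have oD := @chart_domain_open _ _ _ _ hB i.
exact: (mxsmooth_block oD (mxsmooth_cst oD _) (mxsmooth_cst oD _)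
  (mxsmoothN oD (@slope_mxsmooth i)) (mxsmooth_cst oD _)).
Qed.

Lemma chart_mx_lift_frame i (c : 'I_(n + n)) q :
  chart_mx (i : idx B) c (lift_frame i) q =
  block_mx 0 0 (chart_mx (i : idx B) c (slope i) q) 0.
Proof. by rewrite /chart_mx mxpartial_block !mxpartial_cst. Qed.

(** Transformation law of the dual connection on covectors. *)
Lemma dual_connection_change i j p a : dom i p -> dom j p ->
  chart_mx i a (jac j i) p + G i p a *m jac j i p =
  jac j i p *m \sum_e jac i j p e a *: G j p e.
Proof.
move=> ip jp; have [_ tG] := hG.
rewrite mulmx_sumr.
under eq_bigr => e _ do rewrite -scalemxAr (tG j i p jp ip e) scalerDr.
rewrite big_split /=; congr (_ + _).
  rewrite (chart_mx_change hA a ip jp) //.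
  exact: (chart_mxsmooth_diff (@jac_mxsmooth _ _ _ _ hA j i)).
under eq_bigr => e _ do rewrite scaler_sumr.
rewrite exchange_big /=.
transitivity (\sum_c (1%:M : 'M[R]_n) c a *: (G i p c *m jac j i p)).
  rewrite (bigD1 a) //= big1 ?addr0; first by rewrite mxE eqxx scale1r.
  by move=> c /negbTE ca; rewrite mxE ca scale0r.
apply: eq_bigr => c _; rewrite -(jac_inv hA ip jp) mxE scaler_suml.
by apply: eq_bigr => e _; rewrite scalerA mulrC.
Qed.

(** Transition matrix between the frames of two charts. *)
Definition lift_change i j q : 'M[R]_(n + n) :=
  jac_block (jac i j (base q)) (jac j i (base q)).

(** The frames of two charts are related by the Jacobian matrix of the base: this
    says that the horizontal lift does not depend on the chart. *)
Lemma jac_lift_frame i j q : ct_dom i q -> ct_dom j q ->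
  jac (i : idx B) j q *m lift_frame i q = lift_frame j q *m lift_change i j q.
Proof.
move=> iq jq; rewrite (jac_cotangent hA) // /lift_frame /lift_change /jac_block.
rewrite !mulmx_block !mul1mx !mulmx1 !mul0mx !mulmx0 !addr0 !add0r.
congr block_mx; apply/matrixP => b a; rewrite [LHS]mxE.
have -> : ((jac j i (base q))^T *m slope i q) b a =
    (comp q i *m (G i (base q) a *m jac j i (base q))) 0 b.
  rewrite mulmxA [LHS]mxE [RHS]mxE; apply: eq_bigr => l _.
  by rewrite [X in X * _]mxE [slope _ _ _ _]mxE mulrC.
have -> : (slope j q *m jac i j (base q)) b a =
    (comp q i *m (jac j i (base q) *m
       \sum_e jac i j (base q) e a *: G j (base q) e)) 0 b.
  rewrite mulmxA -(comp_change iq jq) mulmx_sumr summxE [LHS]mxE.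
  by apply: eq_bigr => e _; rewrite -scalemxAr [RHS]mxE [slope j q b e]mxE mulrC.
rewrite -(dual_connection_change a iq jq) mulmxDr [RHS]mxE.
by congr (_ + _); rewrite mxE.
Qed.

(** Connection matrices in the lifted frames: [G] on horizontal vectors and its
    dual on vertical vectors, with no derivative along the fibres. *)
Definition lift_christoffel : christoffel B := fun i q c =>
  match fintype.split c with
  | inl a => block_mx (G i (base q) a) 0 0 (- (G i (base q) a)^T)
  | inr _ => 0
  end.

Lemma lift_christoffel_base i q a : lift_christoffel i q (lshift n a) =
  block_mx (G i (base q) a) 0 0 (- (G i (base q) a)^T).
Proof. by rewrite /lift_christoffel (unsplitK (inl a)). Qed.

Lemma lift_christoffel_fiber i q k : lift_christoffel i q (rshift n k) = 0.
Proof. by rewrite /lift_christoffel (unsplitK (inr k)). Qed.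

Lemma lift_christoffel_mxsmooth i (c : 'I_(n + n)) :
  chart_mxsmooth (i : idx B) setT (fun q => lift_christoffel i q c).
Proof.
have oD := @chart_domain_open _ _ _ _ hB i.
rewrite -[c]splitK; case: (fintype.split c) => c' /=.
  have sG := chart_mxsmooth_base hA (@christoffel_mxsmooth i c').
  apply: (mxsmooth_eq oD _ (mxsmooth_block oD sG (mxsmooth_cst oD 0)
    (mxsmooth_cst oD 0) (mxsmoothN oD (mxsmooth_tr oD sG)))).
  by move=> z _; rewrite lift_christoffel_base.
apply: (mxsmooth_eq oD _ (mxsmooth_cst oD 0)).
by move=> z _; rewrite lift_christoffel_fiber.
Qed.

Lemma chart_mx_lift_christoffel i q (c : 'I_(n + n)) a : ct_dom i q ->
  chart_mx (i : idx B) (lshift n a) (fun q => lift_christoffel i q c) q =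
  match fintype.split c with
  | inl b => block_mx (chart_mx i a (fun p => G i p b) (base q)) 0 0
               (- (chart_mx i a (fun p => G i p b) (base q))^T)
  | inr _ => 0
  end.
Proof.
move=> iq; rewrite /lift_christoffel; case: (fintype.split c) => b; last first.
  exact: mxpartial_cst.
rewrite (chart_mx_base hA a (fun p => block_mx (G i p b) 0 0 (- (G i p b)^T))) //.
rewrite /chart_mx mxpartial_block !mxpartial_cst mxpartialN ?mxpartial_tr //.
by apply: mxdiff_tr; exact: dG.
Qed.

Lemma chart_mx_lift_christoffel_fiber i q (c : 'I_(n + n)) k : ct_dom i q ->
  chart_mx (i : idx B) (rshift n k) (fun q => lift_christoffel i q c) q = 0.
Proof.
move=> iq; rewrite /lift_christoffel; case: (fintype.split c) => b; last first.
  exact: mxpartial_cst.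
exact: (chart_mx_base0 hA k (fun p => block_mx (G i p b) 0 0 (- (G i p b)^T))).
Qed.

Lemma lift_christoffel_change i j q : ct_dom i q -> ct_dom j q ->
  forall c : 'I_(n + n),
  lift_change i j q *m lift_christoffel i q c =
  chart_mx (i : idx B) c (lift_change i j) q
  + \sum_(e < n + n) jac (i : idx B) j q e c *:
      (lift_christoffel j q e *m lift_change i j q).
Proof.
move=> iq jq c; rewrite (jac_cotangent hA) // big_split_ord /=.
rewrite [X in _ + (_ + X)]big1 ?addr0; last first.
  by move=> k _; rewrite lift_christoffel_fiber mul0mx scaler0.
rewrite -[c]splitK; case: (fintype.split c) => a /=; last first.
  rewrite lift_christoffel_fiber mulmx0 big1 ?addr0.
    by rewrite (chart_mx_base0 hA a (fun p => jac_block (jac i j p) (jac j i p))).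
  by move=> e _; rewrite block_mxEur mxE scale0r.
under eq_bigr => e _ do rewrite block_mxEul lift_christoffel_base.
rewrite lift_christoffel_base.
rewrite (chart_mx_base hA a (fun p => jac_block (jac i j p) (jac j i p))) //.
rewrite {1}/chart_mx /jac_block mxpartial_block !mxpartial_cst mxpartial_tr.
rewrite /lift_change /jac_block.
under eq_bigr => e _ do rewrite mulmx_block !mul0mx !mulmx0 !addr0 !add0r
  scale_block_mx !scaler0.
have sum_block (F H : 'I_n -> 'M[R]_n) :
    \sum_e block_mx (F e) 0 0 (H e) = block_mx (\sum_e F e) 0 0 (\sum_e H e).
  elim/big_ind3: _ => [|x1 y1 x2 y2 x3 y3 -> ->|//]; first by rewrite block_mx0.
  by rewrite add_block_mx !addr0.
rewrite sum_block mulmx_block add_block_mx !mul0mx !mulmx0 !addr0 !add0r.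
congr block_mx.
  by have [_ tG] := hG; exact: tG.
have := dual_connection_change a iq jq => /(congr1 trmx).
rewrite linearD /= !trmx_mul => E.
have -> : \sum_(e < n) jac i j (base q) e a *:
     (- (G j (base q) e)^T *m (jac j i (base q))^T) =
   - ((\sum_(e < n) jac i j (base q) e a *: G j (base q) e)^T
       *m (jac j i (base q))^T).
  rewrite linear_sum mulmx_suml -sumrN; apply: eq_bigr => e _.
  by rewrite linearZ /= mulNmx scalerN -scalemxAl.
by rewrite -E opprD addrA subrr sub0r mulmxN.
Qed.

End CotangentFrames.

(** * The lifted connection *)

Section LiftedConnection.
Context {R : realType} {n : nat} {M : topologicalType} (A : atlas R n M).
Hypothesis hA : smooth_manifold A.
Notation B := (cotangent_atlas A).
Variable (G : christoffel A).
Hypothesis hG : affine_connection G.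
Implicit Types (i j : idx A) (p : M) (q : cotangent A) (a b e k : 'I_n).

Let hB : smooth_manifold B := cotangent_smooth_manifold hA.

(** Levi-Civita connection of the lifted metric, in coordinates. *)
Definition lift_connection : christoffel B :=
  frame_connection (A := B) (lift_frame G) (lift_coframe G) (lift_christoffel G).

Lemma lift_connection_affine : affine_connection lift_connection.
Proof.
apply: (frame_affine_connection hB (D := lift_change (A := A))).
- exact: (lift_frame_mxsmooth hA hG).
- exact: (lift_coframe_mxsmooth hA hG).
- by move=> i q _; exact: lift_frameK.
- exact: (jac_lift_frame hA hG).
- exact: (lift_christoffel_mxsmooth hA hG).
- exact: (lift_christoffel_change hA hG).
Qed.

Lemma lift_connection_base i q a : ct_dom i q ->
  lift_connection i q (lshift n a) =
  block_mx (G i (base q) a) 0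
    (slope G i q *m G i (base q) a + (G i (base q) a)^T *m slope G i q
       - chart_mx (i : idx B) (lshift n a) (slope G i) q)
    (- (G i (base q) a)^T).
Proof.
move=> iq; rewrite /lift_connection /frame_connection lift_christoffel_base.
rewrite chart_mx_lift_frame /lift_frame /lift_coframe !mulmx_block.
rewrite !mul1mx !mulmx1 !mul0mx !mulmx0 !addr0 !add0r.
rewrite mul0mx addr0 mulmxN mulNmx opprK opp_block_mx add_block_mx.
by rewrite !oppr0 !addr0.
Qed.

Lemma lift_connection_fiber i q k : ct_dom i q ->
  lift_connection i q (rshift n k) =
  block_mx 0 0 (- chart_mx (i : idx B) (rshift n k) (slope G i) q) 0.
Proof.
move=> iq; rewrite /lift_connection /frame_connection lift_christoffel_fiber.
rewrite chart_mx_lift_frame /lift_coframe mulmx0 mul0mx sub0r mulmx_block.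
by rewrite !mulmx1 !mul0mx !mulmx0 !addr0 opp_block_mx !oppr0.
Qed.

(** For a torsion free [G], the vertical part of the lifted connection in two
    base directions is symmetric up to the curvature contracted with the
    covector, which is the bracket of the two horizontal lifts. *)
Lemma lift_connection_base_sym i q a b l : torsion_free G -> ct_dom i q ->
  curvature G i (base q) a b = 0 ->
  (slope G i q *m G i (base q) a + (G i (base q) a)^T *m slope G i q
       - chart_mx (i : idx B) (lshift n a) (slope G i) q) l b =
  (slope G i q *m G i (base q) b + (G i (base q) b)^T *m slope G i q
       - chart_mx (i : idx B) (lshift n b) (slope G i) q) l a.
Proof.
move=> tG iq cG.
pose K c d := G i (base q) d *m G i (base q) c
  - chart_mx i c (fun p => G i p d) (base q).
have E c d : (slope G i q *m G i (base q) c + (G i (base q) c)^T *m slope G i q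
       - chart_mx (i : idx B) (lshift n c) (slope G i) q) l d =
    \sum_m slope G i q l m * G i (base q) c m d + (comp q i *m K c d) 0 l.
  have mxDE (X Y : 'M[R]_n) : (X + Y) l d = X l d + Y l d by rewrite mxE.
  have mxNE (X : 'M[R]_n) : (- X) l d = - X l d by rewrite mxE.
  rewrite !mxDE mxNE -addrA; congr (_ + _); first by rewrite mxE.
  have rwDE (X Y : 'rV[R]_n) : (X - Y) 0 l = X 0 l - Y 0 l by rewrite !mxE.
  rewrite mulmxBr rwDE; congr (_ - _).
    rewrite mulmxA [LHS]mxE [RHS]mxE; apply: eq_bigr => m _.
    by rewrite [X in X * _]mxE [slope _ _ _ _ _]mxE mulrC.
  by have -> := chart_mx_slope hA hG c iq; rewrite [LHS]mxE.
have ES : \sum_m slope G i q l m * G i (base q) a m b =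
    \sum_m slope G i q l m * G i (base q) b m a.
  by apply: eq_bigr => m _; rewrite (tG _ _ iq).
have EK : K a b = K b a.
  move: cG; rewrite /K /curvature !chart_partial_mxE.
  move: (chart_mx i a _ _) (chart_mx i b _ _) (_ *m _) (_ *m _) => X Y U V H.
  apply/eqP; rewrite -subr_eq0 -oppr_eq0 -H; apply/eqP/matrixP => ? ?.
  by rewrite !mxE; ring.
apply: etrans (E a b) _; apply: etrans (esym (E b a)).
by rewrite ES EK.
Qed.

Lemma lift_connection_torsion_free : torsion_free G ->
  (forall i p, dom i p -> forall a b, curvature G i p a b = 0) ->
  torsion_free lift_connection.
Proof.
move=> tG cG i q iq.
have iq' : @ct_dom _ _ _ A i q := iq.
have base_fiber a k m : lift_connection i q (lshift n a) m (rshift n k) =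
    lift_connection i q (rshift n k) m (lshift n a).
  rewrite lift_connection_base // lift_connection_fiber // -[m]splitK.
  case: (fintype.split m) => l /=.
    by rewrite block_mxEur block_mxEul !mxE.
  rewrite block_mxEdr block_mxEdl (chart_mx_slope_fiber hA hG) //.
  by rewrite !mxE.
move=> c d m; rewrite -[c]splitK -[d]splitK.
case: (fintype.split c) => a; case: (fintype.split d) => b //=.
- rewrite !lift_connection_base // -[m]splitK.
  case: (fintype.split m) => l /=; first by rewrite !block_mxEul; exact: tG.
  by rewrite !block_mxEdl; apply: lift_connection_base_sym => //; exact: cG.
- have z (X : 'M[R]_n) (k : 'I_n) :
      (block_mx 0 0 X 0 : 'M[R]_(n + n)) m (rshift n k) = 0.
    rewrite -[m]splitK; case: (fintype.split m) => l /=.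
      by rewrite block_mxEur mxE.
    by rewrite block_mxEdr mxE.
  rewrite (lift_connection_fiber a iq') (lift_connection_fiber b iq').
  exact: etrans (z _ b) (esym (z _ a)).
Qed.

Lemma lift_connection_flat :
  (forall i p, dom i p -> forall a b, curvature G i p a b = 0) ->
  forall i q, ct_dom i q -> forall c d, curvature lift_connection i q c d = 0.
Proof.
move=> cG i q iq c d.
rewrite (curvature_frame hB); last 5 first.
- exact: (lift_frame_mxsmooth hA hG).
- exact: (lift_coframe_mxsmooth hA hG).
- by move=> j q' _; exact: lift_frameK.
- exact: iq.
- move=> e.
  have sW := @lift_christoffel_mxsmooth _ _ _ _ hA _ hG i e.
  exact: (chart_mxsmooth_diff sW iq I).
suff -> : chart_mx (i : idx B) c (fun q => lift_christoffel G i q d) q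
   - chart_mx (i : idx B) d (fun q => lift_christoffel G i q c) q
   + lift_christoffel G i q c *m lift_christoffel G i q d
   - lift_christoffel G i q d *m lift_christoffel G i q c = 0.
  by rewrite mulmx0 mul0mx.
rewrite -[c]splitK -[d]splitK.
case: (fintype.split c) => a; case: (fintype.split d) => b /=; last 3 first.
- rewrite chart_mx_lift_christoffel_fiber // lift_christoffel_fiber.
  rewrite (chart_mx_lift_christoffel hA hG) // (unsplitK (inr b)).
  by rewrite mulmx0 mul0mx !subr0 addr0.
- rewrite chart_mx_lift_christoffel_fiber // lift_christoffel_fiber.
  rewrite (chart_mx_lift_christoffel hA hG) // (unsplitK (inr a)).
  by rewrite mulmx0 mul0mx !subr0 addr0.
- rewrite !chart_mx_lift_christoffel_fiber // !lift_christoffel_fiber.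
  by rewrite mulmx0 !subr0 addr0.
rewrite !(chart_mx_lift_christoffel hA hG) // !(unsplitK (inl _)).
rewrite !lift_christoffel_base !mulmx_block !mul0mx !mulmx0 !addr0 !add0r.
rewrite !opp_block_mx !add_block_mx !oppr0 !addr0 !mulNmx !mulmxN !opprK.
rewrite -(block_mx0 R n n n n); congr block_mx; first exact: (cG i (base q) iq a b).
have := cG i (base q) iq a b => /(congr1 trmx).
rewrite /curvature !chart_partial_mxE trmx0 !linearD !linearN /= !trmx_mul => E.
apply/eqP; rewrite -oppr_eq0 -E; apply/eqP.
by rewrite !opprD !opprK -!addrA; congr (_ + (_ + _)); rewrite addrC.
Qed.

End LiftedConnection.

(** * The lifted Norden structure *)

Section ParallelAlgebra.
Context {R : realType} {n : nat}.
Implicit Types (J g G dJ dg : 'M[R]_n).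

Let trD (X Y : 'M[R]_n) : (X + Y)^T = X^T + Y^T. Proof. exact: linearD. Qed.
Let trN (X : 'M[R]_n) : (- X)^T = - X^T. Proof. exact: linearN. Qed.

(** [dJ] and [dg] stand for the derivatives of [J] and [g] in one direction and
    [G] for the connection matrix; if the covariant derivatives of [J] and [g]
    vanish, so does that of the generalized structure. *)
Lemma Jhat_mx_parallel J g G dJ dg : g^T = g ->
  dJ + G *m J - J *m G = 0 -> dg - G^T *m g - g *m G = 0 ->
  let W : 'M[R]_(n + n) := block_mx G 0 0 (- G^T) in
  block_mx dJ 0 dg^T (- dJ^T) + W *m Jhat_mx J g - Jhat_mx J g *m W = 0.
Proof.
move=> gT nJ ng W; rewrite /W /Jhat_mx !mulmx_block !mul0mx !mulmx0 !addr0 !add0r.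
rewrite opp_block_mx !add_block_mx !oppr0 !addr0 -(block_mx0 R n n n n).
have ngt := congr1 trmx ng; have nJt := congr1 trmx nJ.
move: ngt nJt; rewrite !trD !trN !trmx_mul trmxK trmx0 => ngt nJt.
congr block_mx => //.
  by rewrite -ngt gT mulNmx addrAC.
by rewrite -[RHS]oppr0 -nJt !mulNmx !mulmxN !opprK !opprD !opprK addrAC.
Qed.

(** The same for the generalized metric. *)
Lemma ghat_mx_parallel J g G dJ dg : g^T = g -> g \in unitmx ->
  dJ + G *m J - J *m G = 0 -> dg - G^T *m g - g *m G = 0 ->
  let W : 'M[R]_(n + n) := block_mx G 0 0 (- G^T) in
  block_mx dg (2^-1 *: dJ^T) (2^-1 *: dJ) (- (invmx g *m dg *m invmx g))
    - W^T *m ghat_mx J g - ghat_mx J g *m W = 0.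
Proof.
move=> gT gU nJ ng W; rewrite ghat_mxE // /W tr_block_mx !trmx0.
rewrite !mulmx_block !mul0mx !mulmx0 !addr0 !add0r.
rewrite !opp_block_mx !add_block_mx -(block_mx0 R n n n n).
have nJt := congr1 trmx nJ.
move: nJt; rewrite !trD !trN !trmx_mul trmx0 trmxK => nJt.
congr block_mx => //.
- rewrite -!scalemxAl -!scalemxAr -!scalerBr mulmxN opprK.
  by rewrite -[RHS](scaler0 _ 2^-1) -nJt addrAC.
- rewrite -!scalemxAl -!scalemxAr -!scalerBr mulNmx opprK.
  by rewrite -[RHS](scaler0 _ 2^-1) -nJ.
have -> : dg = G^T *m g + g *m G.
  by apply/eqP; rewrite -subr_eq0 opprD addrA ng.
rewrite mulmxDr mulmxDl !mulmxN !mulNmx !opprK.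
rewrite !mulmxA mulVmx // mul1mx -(mulmxA _ g) mulmxV // mulmx1.
by mx_abel.
Qed.

End ParallelAlgebra.

Section CotangentNorden.
Context {R : realType} {n : nat} {M : topologicalType} (A : atlas R n M).
Notation B := (cotangent_atlas A).
Variables (J g : tensor2 A) (G : christoffel A).
Hypothesis hN : norden_manifold J g.
Hypothesis hG : levi_civita g G.
Hypothesis nJ : forall i p, dom i p -> forall a, nabla_endo G J i p a = 0.
Implicit Types (i j : idx A) (p : M) (q : cotangent A) (a b : 'I_n).

Let hA : smooth_manifold A. Proof. by have [] := hN. Qed.
Let hB : smooth_manifold B := cotangent_smooth_manifold hA.
Let aG : affine_connection G. Proof. by have [] := hG. Qed.

Let gT i p : dom i p -> (g i p)^T = g i p.
Proof. by move=> ip; have [_ _ [_ gs _] _] := hN; apply/form_symP; exact: gs. Qed.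

Let gU i p : dom i p -> g i p \in unitmx.
Proof. by move=> ip; have [_ _ [_ _ gn] _] := hN; apply/form_nondegenerateP; exact: gn. Qed.

Let JJ i p : dom i p -> J i p *m J i p = - 1%:M.
Proof. by have [_ [_ JJ] _ _] := hN; exact: JJ. Qed.

Let Jg i p : dom i p -> (J i p)^T *m g i p = g i p *m J i p.
Proof. by move=> ip; have [_ _ _ Jg] := hN; apply/form_adjointP; exact: Jg. Qed.

Let sJ i : chart_mxsmooth i setT (J i).
Proof. by have [_ [[sJ _] _] _ _] := hN; exact: sJ. Qed.

Let sg i : chart_mxsmooth i setT (g i).
Proof. by have [_ _ [[sg _] _ _] _] := hN; exact: sg. Qed.

Let dJ i p : dom i p -> chart_mxdiff i (J i) p.
Proof. by move=> ip; exact: (chart_mxsmooth_diff (@sJ i) ip I). Qed.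

Let dg i p : dom i p -> chart_mxdiff i (g i) p.
Proof. by move=> ip; exact: (chart_mxsmooth_diff (@sg i) ip I). Qed.


Let nJ' i p a : dom i p ->
  chart_mx i a (J i) p + G i p a *m J i p - J i p *m G i p a = 0.
Proof. by move=> ip; exact: nJ. Qed.

Let ng i p a : dom i p ->
  chart_mx i a (g i) p - (G i p a)^T *m g i p - g i p *m G i p a = 0.
Proof. by move=> ip; have [_ _ ng] := hG; exact: ng. Qed.

(** The lifted structures have the matrices of [Jhat] and [ghat] as components in
    the frame of lifts. *)
Lemma Jtilde_frame : Jtilde J g G =
  frame_endo (A := B) (lift_frame G) (lift_coframe G)
    (fun i q => Jhat_mx (J i (base q)) (g i (base q))).
Proof.
apply/funext => i; apply/funext => q.
rewrite /Jtilde /frame_endo PhiE invmx_lift_frame -[RHS]mx_of_map_mul.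
by congr mx_of_map; apply/funext => u; rewrite JhatE !mulmxA.
Qed.

Lemma gtilde_frame : gtilde J g G =
  frame_form (A := B) (lift_coframe G)
    (fun i q => ghat_mx (J i (base q)) (g i (base q))).
Proof.
apply/funext => i; apply/funext => q.
rewrite /gtilde /frame_form PhiE invmx_lift_frame -[RHS]mx_of_form_form.
congr mx_of_form; apply/funext => u; apply/funext => v.
by rewrite ghatE form_mull form_mulr.
Qed.

Lemma Jhat_mxsmooth i : chart_mxsmooth i setT (fun p => Jhat_mx (J i p) (g i p)).
Proof.
have oD := @chart_domain_open _ _ _ _ hA i.
exact: (mxsmooth_block oD (@sJ i) (mxsmooth_cst oD 0) (mxsmooth_tr oD (@sg i))
  (mxsmoothN oD (mxsmooth_tr oD (@sJ i)))).
Qed.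

Lemma chart_mx_Jhat i a p : dom i p ->
  chart_mx i a (fun p => Jhat_mx (J i p) (g i p)) p =
  block_mx (chart_mx i a (J i) p) 0 (chart_mx i a (g i) p)^T
    (- (chart_mx i a (J i) p)^T).
Proof.
move=> ip; rewrite /chart_mx /Jhat_mx mxpartial_block mxpartial_cst.
rewrite mxpartialN; last exact: mxdiff_tr (dJ ip).
by rewrite !mxpartial_tr.
Qed.

(* Scalars are written as scalar matrices, so that products of matrix valued
   functions suffice for smoothness. *)
Let ghatE' i p : dom i p -> setT p ->
  block_mx (g i p) ((2^-1)%:M *m (J i p)^T) ((2^-1)%:M *m J i p) (invmx (g i p)) =
  ghat_mx (J i p) (g i p).
Proof. by move=> ip _; rewrite ghat_mxE ?gT ?gU // !mul_scalar_mx. Qed.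

Let sginv i : chart_mxsmooth i setT (fun p => invmx (g i p)).
Proof.
have oD := @chart_domain_open _ _ _ _ hA i.
by apply: (mxsmooth_inv oD) (@sg i) => x /(param_dom hA)[ix _ _]; exact: gU.
Qed.

Lemma ghat_mxsmooth i : chart_mxsmooth i setT (fun p => ghat_mx (J i p) (g i p)).
Proof.
apply: (chart_mxsmooth_eq hA openT (@ghatE' i)).
have oD := @chart_domain_open _ _ _ _ hA i.
exact: (mxsmooth_block oD (@sg i)
  (mxsmoothM oD (mxsmooth_cst oD _) (mxsmooth_tr oD (@sJ i)))
  (mxsmoothM oD (mxsmooth_cst oD _) (@sJ i)) (@sginv i)).
Qed.

Lemma chart_mx_ghat i a p : dom i p ->
  chart_mx i a (fun p => ghat_mx (J i p) (g i p)) p =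
  block_mx (chart_mx i a (g i) p) (2^-1 *: (chart_mx i a (J i) p)^T)
    (2^-1 *: chart_mx i a (J i) p)
    (- (invmx (g i p) *m chart_mx i a (g i) p *m invmx (g i p))).
Proof.
move=> ip; rewrite -(near_eq_chart_mx hA a openT ip I (@ghatE' i)).
have dgi : chart_mxdiff i (fun p => invmx (g i p)) p.
  exact: (chart_mxsmooth_diff (@sginv i) ip I).
have gginv p' : dom i p' -> g i p' *m invmx (g i p') = 1%:M.
  by move=> ip'; rewrite mulmxV // gU.
rewrite -(chart_mx_inv hA a gginv (dg ip) dgi ip).
rewrite {1}/chart_mx mxpartial_block; congr block_mx.
  rewrite mxpartialMl ?mul_scalar_mx ?mxpartial_tr //.
  exact: mxdiff_tr (dJ ip).
by rewrite mxpartialMl ?mul_scalar_mx //; exact: dJ.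
Qed.

Lemma Jtilde_parallel i q (c : 'I_(n + n)) : ct_dom i q ->
  nabla_endo (lift_connection G) (Jtilde J g G) i q c = 0.
Proof.
move=> iq; rewrite Jtilde_frame.
have sT := chart_mxsmooth_base hA (@Jhat_mxsmooth i).
rewrite (nabla_endo_frame hB); last 5 first.
- exact: (lift_frame_mxsmooth hA aG).
- exact: (lift_coframe_mxsmooth hA aG).
- by move=> j q' _; exact: lift_frameK.
- exact: iq.
- exact: (chart_mxsmooth_diff sT iq I).
set X := (X in _ *m X *m _); suff -> : X = 0 by rewrite mulmx0 mul0mx.
rewrite /X -[c]splitK; case: (fintype.split c) => a /=.
  rewrite lift_christoffel_base.
  rewrite (chart_mx_base hA a (fun p => Jhat_mx (J i p) (g i p)) iq).
  rewrite (chart_mx_Jhat a iq).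
  apply: Jhat_mx_parallel; [exact: gT|exact: nJ'|exact: ng].
rewrite lift_christoffel_fiber mulmx0 mul0mx subr0 addr0.
exact: (chart_mx_base0 hA a (fun p => Jhat_mx (J i p) (g i p)) iq).
Qed.

Lemma gtilde_parallel i q (c : 'I_(n + n)) : ct_dom i q ->
  nabla_form (lift_connection G) (gtilde J g G) i q c = 0.
Proof.
move=> iq; rewrite gtilde_frame.
have sT := chart_mxsmooth_base hA (@ghat_mxsmooth i).
rewrite (nabla_form_frame hB); last 5 first.
- exact: (lift_frame_mxsmooth hA aG).
- exact: (lift_coframe_mxsmooth hA aG).
- by move=> j q' _; exact: lift_frameK.
- exact: iq.
- exact: (chart_mxsmooth_diff sT iq I).
set X := (X in _ *m X *m _); suff -> : X = 0 by rewrite mulmx0 mul0mx.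
rewrite /X -[c]splitK; case: (fintype.split c) => a /=.
  rewrite lift_christoffel_base.
  rewrite (chart_mx_base hA a (fun p => ghat_mx (J i p) (g i p)) iq).
  rewrite (chart_mx_ghat a iq).
  apply: ghat_mx_parallel; [exact: gT|exact: gU|exact: nJ'|exact: ng].
rewrite lift_christoffel_fiber trmx0 mulmx0 mul0mx !subr0.
exact: (chart_mx_base0 hA a (fun p => ghat_mx (J i p) (g i p)) iq).
Qed.

Lemma Jtilde_endomorphism : endomorphism_field (Jtilde J g G).
Proof.
rewrite Jtilde_frame.
apply: (frame_endomorphism_field hB (D := lift_change (A := A))).
- exact: (lift_frame_mxsmooth hA aG).
- exact: (lift_coframe_mxsmooth hA aG).
- by move=> i q _; exact: lift_frameK.
- exact: (jac_lift_frame hA aG).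
- by move=> i; exact: (chart_mxsmooth_base hA (@Jhat_mxsmooth i)).
move=> i j q iq jq; have [_ [[_ tJ] _] [[_ tg] _ _] _] := hN.
apply: Jhat_mx_change.
- exact: (jac_inv hA iq jq).
- exact: tJ.
- exact: tg.
- exact: gT.
- exact: gT.
Qed.

Lemma gtilde_bilinear : bilinear_field (gtilde J g G).
Proof.
rewrite gtilde_frame.
apply: (frame_bilinear_field hB (P := lift_frame G) (D := lift_change (A := A))).
- exact: (lift_coframe_mxsmooth hA aG).
- by move=> i q _; exact: lift_frameK.
- exact: (jac_lift_frame hA aG).
- by move=> i; exact: (chart_mxsmooth_base hA (@ghat_mxsmooth i)).
move=> i j q iq jq; have [_ [[_ tJ] _] [[_ tg] _ _] _] := hN.
apply: ghat_mx_change.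
- exact: (jac_inv hA iq jq).
- exact: tJ.
- exact: tg.
- exact: gT.
- exact: gU.
- exact: gT.
- exact: gU.
Qed.

Let QP i q : lift_coframe G i q *m lift_frame G i q = 1%:M.
Proof. exact/mulmx1C/lift_frameK. Qed.

Lemma gtilde_tr i q : ct_dom i q -> (gtilde J g G i q)^T = gtilde J g G i q.
Proof.
move=> iq; rewrite gtilde_frame /frame_form !trmx_mul trmxK ghat_mx_tr ?mulmxA //.
- exact: gT.
- exact: gU.
Qed.

Lemma gtilde_unit i q : ct_dom i q -> gtilde J g G i q \in unitmx.
Proof.
move=> iq; rewrite gtilde_frame /frame_form !unitmx_mul unitmx_tr.
have [_ uQ] := mulmx1_unit (lift_frameK G i q).
rewrite uQ /= andbT; apply: ghat_mx_unit; [exact: gT|exact: gU|exact: JJ|exact: Jg].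
Qed.

Lemma Jtilde_sq i q : ct_dom i q ->
  Jtilde J g G i q *m Jtilde J g G i q = - 1%:M.
Proof.
move=> iq; rewrite Jtilde_frame /frame_endo.
set P := lift_frame G i q; set Q := lift_coframe G i q; set T := Jhat_mx _ _.
have -> : P *m T *m Q *m (P *m T *m Q) = P *m (T *m T) *m Q.
  by rewrite !mulmxA -(mulmxA _ Q P) QP mulmx1.
rewrite Jhat_mx_sq; [|exact: gT|exact: JJ|exact: Jg].
by rewrite mulmxN mulmx1 mulNmx lift_frameK.
Qed.

Lemma Jtilde_gtilde_adjoint i q : ct_dom i q ->
  (Jtilde J g G i q)^T *m gtilde J g G i q = gtilde J g G i q *m Jtilde J g G i q.
Proof.
move=> iq; rewrite Jtilde_frame gtilde_frame /frame_endo /frame_form.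
set P := lift_frame G i q; set Q := lift_coframe G i q.
set T := Jhat_mx _ _; set H := ghat_mx _ _.
have TH : T^T *m H = H *m T.
  by apply: Jhat_ghat_adjoint; [exact: gT|exact: gU|exact: JJ|exact: Jg].
have PQt : P^T *m Q^T = 1%:M by rewrite -trmx_mul QP trmx1.
rewrite !trmx_mul !mulmxA -(mulmxA _ P^T) PQt mulmx1.
by rewrite -(mulmxA _ Q P) QP mulmx1 -(mulmxA _ T^T) TH mulmxA.
Qed.

Lemma cotangent_norden : norden_manifold (Jtilde J g G) (gtilde J g G).
Proof.
split=> //.
- by split; [exact: Jtilde_endomorphism|exact: Jtilde_sq].
- split; first exact: gtilde_bilinear.
    by move=> i q iq; apply/form_symP; exact: gtilde_tr.
  by move=> i q iq; apply/form_nondegenerateP; exact: gtilde_unit.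
- by move=> i q iq; apply/form_adjointP; exact: Jtilde_gtilde_adjoint.
Qed.

Hypothesis cG : forall i p, dom i p -> forall a b, curvature G i p a b = 0.

Lemma lift_connection_levi_civita : levi_civita (gtilde J g G) (lift_connection G).
Proof.
split.
- exact: lift_connection_affine.
- by have [_ tG _] := hG; exact: lift_connection_torsion_free.
- by move=> i q iq c; exact: gtilde_parallel.
Qed.

Lemma cotangent_flat_kahler_norden :
  flat_kahler_norden_manifold (Jtilde J g G) (gtilde J g G).
Proof.
have lc := lift_connection_levi_civita.
split; first split.
- exact: cotangent_norden.
- by exists (lift_connection G) => // i q iq c; exact: Jtilde_parallel.
- by exists (lift_connection G) => // i q iq c d; exact: lift_connection_flat.
Qed.

End CotangentNorden.

Lemma curvature_eq (R : realType) n (M : topologicalType) (A : atlas R n M)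
    (G G' : christoffel A) i p a b : smooth_manifold A ->
  (forall p, dom i p -> forall a, G i p a = G' i p a) -> dom i p ->
  curvature G i p a b = curvature G' i p a b.
Proof.
move=> hA GG ip; rewrite /curvature !chart_partial_mxE.
have D c d : chart_mx i c (fun q => G i q d) p = chart_mx i c (fun q => G' i q d) p.
  by apply: (near_eq_chart_mx hA c openT ip I) => q iq _; exact: GG.
by rewrite (D a b) (D b a) (GG p ip a) (GG p ip b).
Qed.

Theorem proposition4p5 (R : realType) (n : nat) (M : topologicalType)
    (A : atlas R n M) (J g : tensor2 A) (nabla : christoffel A)
    (hM : flat_kahler_norden_manifold J g) (hnabla : levi_civita g nabla) :
  flat_kahler_norden_manifold (Jtilde J g nabla) (gtilde J g nabla).
Proof.
have [[hN [G1 lc1 J0]] [G2 lc2 C0]] := hM.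
have [hA _ pg _] := hN.
apply: cotangent_flat_kahler_norden => //.
- move=> i p ip a; rewrite -[RHS](J0 i p ip a) /nabla_endo.
  by rewrite (levi_civita_unique pg hnabla lc1).
- move=> i p ip a b; rewrite -[RHS](C0 i p ip a b).
  by apply: curvature_eq => // q iq c; exact: (levi_civita_unique pg hnabla lc2).
Qed.
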